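(* Let $F_2$ be the free group of rank $2$. There does not exist an automorphism of $F_2$ which has a parabolic orbit in $\partial F_2$.
   Context: $\partial F_2$ denotes the Gromov boundary of $F_2$: having fixed a basis, it is the set of right-infinite reduced words in the basis elements and their inverses, with the topology generated by the cylinders (sets of infinite reduced words having a given finite prefix). Any $\varphi\in\mathrm{Aut}(F_2)$ induces a homeomorphism $\partial\varphi$ of $\partial F_2$. An automorphism $\varphi$ has a parabolic orbit if there exist points $X\neq Y$ in $\partial F_2$ such that $\lim_{k\to+\infty}\partial\varphi^{k}(Y)=X$ and $\lim_{k\to-\infty}\partial\varphi^{k}(Y)=X$. *)

(* Defs.v *)
From HB Require Import structures.
From mathcomp Require Import all_boot.
From mathcomp Require Import all_classical topology.

Set Implicit Arguments.
Unset Strict Implicit.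
Unset Printing Implicit Defensive.

Local Open Scope classical_set_scope.
Local Open Scope group_scope.

(* The letter (i, false) is the i-th basis element, (i, true) its inverse. *)
Notation letter := ('I_2 * bool)%type.

Definition letter_inv (a : letter) : letter := (a.1, ~~ a.2).

Lemma letter_invK : involutive letter_inv.
Proof. by move=> [i b]; rewrite /letter_inv /= negbK. Qed.

Lemma letter_inv_neq a : a != letter_inv a.
Proof. by case: a => i [] ; rewrite xpair_eqE andbF. Qed.

Lemma eq_letter_inv a b : (a == letter_inv b) = (b == letter_inv a).
Proof. by apply/eqP/eqP => ->; rewrite letter_invK. Qed.

Definition reduced (w : seq letter) : bool :=
  sorted (fun a b => b != letter_inv a) w.

(* Left multiplication of a reduced word by a letter. *)
Definition push (a : letter) (w : seq letter) : seq letter :=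
  if w is b :: w' then if b == letter_inv a then w' else a :: w else [:: a].

Lemma reduced_cons a w :
  reduced (a :: w) = (if w is b :: _ then b != letter_inv a else true)
                     && reduced w.
Proof. by case: w => [|b w]. Qed.

Lemma push_reduced a w : reduced w -> reduced (push a w).
Proof.
case: w => [//|b w] rbw; rewrite /push; case: ifPn => [_|nba].
  by move: rbw; rewrite reduced_cons => /andP[].
by rewrite reduced_cons nba.
Qed.

Lemma push_cons a w : reduced (a :: w) -> push a w = a :: w.
Proof.
by case: w => [//|b w]; rewrite reduced_cons /push => /andP[/negbTE->].
Qed.

Lemma pushK a w : reduced w -> push a (push (letter_inv a) w) = w.
Proof.
case: w => [_|b w rbw]; first by rewrite /push eqxx.
rewrite {2}/push letter_invK; case: eqP => [eba|_]; last by rewrite /push eqxx.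
by subst b; rewrite push_cons.
Qed.

Definition mulw (u v : seq letter) : seq letter := foldr push v u.
Definition invw (u : seq letter) : seq letter := rev (map letter_inv u).

Lemma mulw_reduced u v : reduced v -> reduced (mulw u v).
Proof. by move=> rv; elim: u => //= a u; apply: push_reduced. Qed.

Lemma mulw_push a u v : reduced u -> reduced v ->
  mulw (push a u) v = push a (mulw u v).
Proof.
case: u => [//|b u] _ rv; rewrite {1}/push; case: eqP => [->|//] /=.
by rewrite pushK// mulw_reduced.
Qed.

Lemma mulwA u v w : reduced v -> reduced w ->
  mulw u (mulw v w) = mulw (mulw u v) w.
Proof.
by move=> rv rw; elim: u => //= a u ->; rewrite mulw_push// mulw_reduced.
Qed.

Lemma mulw_cat u v : reduced (u ++ v) -> mulw u v = u ++ v.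
Proof.
elim: u => [//|a u IHu]; rewrite cat_cons => rauv.
rewrite -[LHS]/(push a (mulw u v)) IHu ?push_cons//.
by move: rauv; rewrite reduced_cons => /andP[].
Qed.

Lemma mulws0 u : reduced u -> mulw u [::] = u.
Proof. by move=> ru; rewrite mulw_cat cats0. Qed.

Lemma invw_reduced u : reduced u -> reduced (invw u).
Proof.
rewrite /reduced /invw rev_sorted sorted_map; apply: sub_sorted => a b /=.
by rewrite letter_invK eq_sym.
Qed.

Lemma mulVw u : mulw (invw u) u = [::].
Proof.
elim: u => // a u IHu.
by rewrite /invw /= rev_cons -cats1 /mulw foldr_cat /= letter_invK eqxx.
Qed.

Lemma invwK : involutive invw.
Proof. by move=> u; rewrite /invw map_rev revK (mapK letter_invK). Qed.

Lemma mulwV u : mulw u (invw u) = [::].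
Proof. by rewrite -{1}(invwK u) mulVw. Qed.

Record F2 := ReducedWord { word :> seq letter; wordP : reduced word }.

HB.instance Definition _ := [isSub for word].
HB.instance Definition _ := [Choice of F2 by <:].

Definition F2_one : F2 := @ReducedWord [::] isT.
Definition F2_inv (x : F2) : F2 := ReducedWord (invw_reduced (wordP x)).
Definition F2_mul (x y : F2) : F2 := ReducedWord (mulw_reduced x (wordP y)).

Lemma F2_mulA : associative F2_mul.
Proof. by move=> x y z; apply/val_inj; rewrite /= mulwA ?wordP. Qed.
Lemma F2_mul1 : left_id F2_one F2_mul.
Proof. by move=> x; apply/val_inj. Qed.
Lemma F2_mulr1 : right_id F2_one F2_mul.
Proof. by move=> x; apply/val_inj; rewrite /= mulws0 ?wordP. Qed.
Lemma F2_mulV : left_inverse F2_one F2_inv F2_mul.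
Proof. by move=> x; apply/val_inj; rewrite /= mulVw. Qed.
Lemma F2_mulrV : right_inverse F2_one F2_inv F2_mul.
Proof. by move=> x; apply/val_inj; rewrite /= mulwV. Qed.

HB.instance Definition _ :=
  isGroup.Build F2 F2_mulA F2_mul1 F2_mulr1 F2_mulV F2_mulrV.

Definition basis (i : 'I_2) : F2 := @ReducedWord [:: (i, false)] isT.
Definition F2_letter (a : letter) : F2 := @ReducedWord [:: a] isT.

Lemma F2_letterE a :
  F2_letter a = if a.2 then (basis a.1)^-1 else basis a.1.
Proof. by case: a => i []; apply/val_inj. Qed.

Lemma F2_elim (P : F2 -> Prop) : P 1 ->
  (forall a (x : F2), reduced (a :: x) -> P x -> P (F2_letter a * x)) ->
  forall x, P x.
Proof.
move=> P1 PM [w]; elim: w => [|a w IHw] rw.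
  by rewrite (_ : ReducedWord rw = 1)//; apply/val_inj.
have rw2 : reduced w by move: rw; rewrite reduced_cons => /andP[].
rewrite (_ : ReducedWord rw = F2_letter a * ReducedWord rw2).
  by apply: PM => //; apply: IHw.
by apply/val_inj; rewrite /= push_cons.
Qed.

(* The universal property: F2 is free on basis. *)
Lemma F2_free (G : groupType) (g : 'I_2 -> G) :
  exists! f : F2 -> G, {morph f : x y / x * y} /\ (forall i, f (basis i) = g i).
Proof.
pose gl (a : letter) := if a.2 then (g a.1)^-1 else g a.1.
pose f (w : seq letter) := foldr (fun a y => gl a * y) 1 w.
have glV a : gl (letter_inv a) = (gl a)^-1.
  by case: a => i []; rewrite /gl//= invgK.
have fpush a w : f (push a w) = gl a * f w.
  case: w => //= b w; case: eqP => [->|//].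
  by rewrite glV mulgA mulgV mul1g.
have fM u v : f (mulw u v) = f u * f v.
  by elim: u => [|a u IHu] /=; rewrite ?mul1g// fpush IHu mulgA.
exists (fun x => f x); split.
  by split => [x y|i]; rewrite ?fM//= /gl/= mulg1.
move=> h [hM hb]; apply/funext => x.
have h1 : h 1 = 1 by apply: (mulgI (h 1)); rewrite -hM !mulg1.
elim/F2_elim: x => [|a x rx IHx]; first by rewrite h1.
rewrite hM -IHx fM /= mulg1; congr (_ * _).
rewrite F2_letterE /gl; case: a {rx} => i [] /=; rewrite ?hb//.
by apply: (mulgI (h (basis i))); rewrite -hM !mulgV h1 hb mulgV.
Qed.

Record autF2 := AutF2 {
  aut_fun :> F2 -> F2;
  aut_morph : {morph aut_fun : x y / x * y};
  aut_bij : bijective aut_fun }.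

HB.instance Definition _ := gen_eqMixin autF2.
HB.instance Definition _ := gen_choiceMixin autF2.

Lemma autF2P (phi psi : autF2) : aut_fun phi =1 psi -> phi = psi.
Proof.
case: phi psi => [f fM fb] [g gM gb] /= /funext fg; subst g.
by congr AutF2; exact: Prop_irrelevance.
Qed.

Lemma aut_ex_inv (phi : autF2) (y : F2) : exists x, phi x == y.
Proof. by have [g _ fK] := aut_bij phi; exists (g y); rewrite fK. Qed.

Definition aut_inv_fun (phi : autF2) (y : F2) : F2 := xchoose (aut_ex_inv phi y).

Lemma aut_inv_funK (phi : autF2) : cancel (aut_inv_fun phi) phi.
Proof. by move=> y; apply/eqP/(xchooseP (aut_ex_inv phi y)). Qed.

Lemma aut_funK (phi : autF2) : cancel phi (aut_inv_fun phi).
Proof. by move=> x; apply: (bij_inj (aut_bij phi)); rewrite aut_inv_funK. Qed.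

Lemma aut_inv_morph (phi : autF2) : {morph aut_inv_fun phi : x y / x * y}.
Proof.
move=> x y; apply: (bij_inj (aut_bij phi)).
by rewrite aut_morph !aut_inv_funK.
Qed.

Definition aut_one : autF2 :=
  @AutF2 id (fun _ _ => erefl) (Bijective (fun _ => erefl) (fun _ => erefl)).

Definition aut_inv (phi : autF2) : autF2 :=
  AutF2 (@aut_inv_morph phi) (Bijective (@aut_inv_funK phi) (@aut_funK phi)).

Lemma aut_mul_morph (phi psi : autF2) : {morph phi \o psi : x y / x * y}.
Proof. by move=> x y; rewrite /= !aut_morph. Qed.

Definition aut_mul (phi psi : autF2) : autF2 :=
  AutF2 (aut_mul_morph phi psi) (bij_comp (aut_bij phi) (aut_bij psi)).

Lemma aut_mulA : associative aut_mul.
Proof. by move=> x y z; apply/autF2P. Qed.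
Lemma aut_mul1 : left_id aut_one aut_mul.
Proof. by move=> x; apply/autF2P. Qed.
Lemma aut_mulr1 : right_id aut_one aut_mul.
Proof. by move=> x; apply/autF2P. Qed.
Lemma aut_mulV : left_inverse aut_one aut_inv aut_mul.
Proof. by move=> x; apply/autF2P => y; apply: aut_funK. Qed.
Lemma aut_mulrV : right_inverse aut_one aut_inv aut_mul.
Proof. by move=> x; apply/autF2P => y; apply: aut_inv_funK. Qed.

(* Aut(F2), with (phi * psi) x = phi (psi x). *)
HB.instance Definition _ :=
  isGroup.Build autF2 aut_mulA aut_mul1 aut_mulr1 aut_mulV aut_mulrV.

Record boundary := InfWord {
  inf_word :> nat -> letter;
  inf_wordP : forall n, inf_word n.+1 != letter_inv (inf_word n) }.

HB.instance Definition _ := gen_eqMixin boundary.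
HB.instance Definition _ := gen_choiceMixin boundary.

Lemma boundaryP (X Y : boundary) : inf_word X =1 Y -> X = Y.
Proof.
case: X Y => [x xP] [y yP] /= /funext xy; subst y.
by congr InfWord; exact: Prop_irrelevance.
Qed.

Lemma trunc_reduced (X : boundary) n : reduced (mkseq X n).
Proof.
apply/(sortedP (X 0)) => i; rewrite size_mkseq => lt_in.
by rewrite !nth_mkseq ?inf_wordP// ltnW.
Qed.

Definition trunc (X : boundary) (n : nat) : F2 :=
  ReducedWord (trunc_reduced X n).

Definition cylinder (w : seq letter) : set boundary :=
  [set X | mkseq X (size w) = w].

Lemma take_mkseq T (X : nat -> T) m n :
  m <= n -> take m (mkseq X n) = mkseq X m.
Proof. by move=> mn; rewrite /mkseq -map_take take_iota (minn_idPl mn). Qed.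

Lemma cylinder_cover : \bigcup_(w in [set: seq letter]) cylinder w = setT.
Proof. by apply/seteqP; split => // X _; exists [::]. Qed.

Lemma cylinder_join (u v : seq letter) (X : boundary) : setT u -> setT v ->
  cylinder u X -> cylinder v X ->
  exists w, [/\ setT w, cylinder w X & cylinder w `<=` cylinder u `&` cylinder v].
Proof.
move=> _ _ uX vX; pose n := maxn (size u) (size v).
exists (mkseq X n); split => //; rewrite /cylinder /= size_mkseq// => Y /= XY.
by split; rewrite -(@take_mkseq _ _ _ n) ?XY ?take_mkseq// ?leq_maxl ?leq_maxr.
Qed.

HB.instance Definition _ := isPointed.Build (seq letter) [::].
HB.instance Definition _ :=
  @isBaseTopological.Build boundary (seq letter) setT cylinder
    cylinder_cover cylinder_join.

Lemma open_cylinder w : open (cylinder w).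
Proof.
by exists [set w] => //; rewrite bigcup_set1.
Qed.

Lemma nbhs_boundaryE (X : boundary) (A : set boundary) :
  nbhs X A <-> exists n, cylinder (trunc X n) `<=` A.
Proof.
rewrite nbhsE; split=> [[_ [[D _ <-] [w Dw wX]] DA]|[n nA]].
  exists (size w) => Y; rewrite /cylinder/= size_mkseq wX => wY.
  by apply: DA; exists w.
exists (cylinder (trunc X n)) => //; split; first exact: open_cylinder.
by rewrite /cylinder/= size_mkseq.
Qed.

(* Convergence of a sequence of elements of F2 to a boundary point, in the
   compactification of F2 by its boundary. *)
Definition tends_to (u : nat -> F2) (X : boundary) : Prop :=
  forall n, \forall k \near \oo, prefix (trunc X n) (u k).

(* The image of X is the limit of phi (trunc X k) as k grows; it exists and is
   unique by boundary_mapP and tends_to_unique, so that the default value of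
   xget is irrelevant. *)
Definition boundary_map (phi : autF2) (X : boundary) : boundary :=
  xget X (tends_to (fun k => phi (trunc X k))).

Lemma tends_toP (u : nat -> F2) (X : boundary) : tends_to u X <->
  forall n, exists K, forall k, K <= k -> take n (u k) = trunc X n.
Proof.
split=> uX n; have := uX n.
  move=> [K _ uK]; exists K => k Kk.
  by have := uK k Kk; rewrite /= prefixE size_mkseq => /eqP.
move=> [K uK]; exists K => // k Kk /=.
by rewrite prefixE size_mkseq uK.
Qed.

Lemma eq_boundary (X Y : boundary) :
  (forall n, mkseq X n = mkseq Y n) -> X = Y.
Proof.
move=> XY; apply/boundaryP => n; have := congr1 (nth (X 0) ^~ n) (XY n.+1).
by rewrite !nth_mkseq.
Qed.

Lemma tends_to_unique (u : nat -> F2) (X Y : boundary) :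
  tends_to u X -> tends_to u Y -> X = Y.
Proof.
move=> /tends_toP uX /tends_toP uY; apply: eq_boundary => n.
have [K uK] := uX n; have [L uL] := uY n.
have := uL _ (leq_maxr K L); rewrite uK ?leq_maxl//.
Qed.

Lemma tends_to_ex (u : nat -> F2) (M : nat -> nat) (p : nat -> seq letter) :
  (forall n k, M n <= k -> take n (u k) = p n) -> (forall n, size (p n) = n) ->
  exists X, tends_to u X.
Proof.
move=> up sp.
have pE m n : m <= n -> p m = take m (p n).
  move=> mn; rewrite -(up m _ (leq_maxl _ (M n))) -(up n _ (leq_maxr (M m) _)).
  by rewrite take_takel.
have rp n : reduced (p n).
  by rewrite -(up n _ (leqnn _)); apply: take_sorted; apply: wordP.
pose a0 : letter := (ord0, false).
have ZP n : nth a0 (p n.+2) n.+1 != letter_inv (nth a0 (p n.+1) n).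
  rewrite (pE n.+1 n.+2)// nth_take//.
  by have /sortedP := rp n.+2; apply; rewrite sp.
exists (InfWord ZP); apply/tends_toP => n; exists (M n) => k /up ->.
apply: (@eq_from_nth _ a0); rewrite /= ?size_mkseq ?sp// => i lt_in.
by rewrite nth_mkseq//= (pE i.+1 n)// nth_take.
Qed.

Lemma size_push a w : size (push a w) <= (size w).+1.
Proof. by case: w => //= b w; case: ifP => //= _; rewrite ltnW. Qed.

Lemma size_mulw u v : size (mulw u v) <= size u + size v.
Proof.
by elim: u => //= a u IHu; apply: leq_trans (size_push _ _) _; rewrite ltnS.
Qed.

Lemma reduced_rcons w b a : reduced (rcons w b) -> a != letter_inv b ->
  reduced (rcons (rcons w b) a).
Proof.
case: w => [|c w] /=; first by move=> _ ->.
by rewrite !rcons_path last_rcons => -> ->.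
Qed.

Lemma mulw_letter u a : reduced u ->
  mulw u [:: a] = rcons u a \/ exists2 u', u = rcons u' (letter_inv a) &
                                          mulw u [:: a] = u'.
Proof.
case: (lastP u) => [|u' b] ru; first by left.
case: (eqVneq a (letter_inv b)) => [eab|nab].
  right; exists u'; first by rewrite eab letter_invK.
  rewrite eab -cats1 /mulw foldr_cat /= eqxx -/(mulw _ _) mulws0//.
  by move: ru; rewrite -cats1 => /cat_sorted2[].
by left; rewrite mulw_cat cats1 ?reduced_rcons.
Qed.

Lemma take_mulw (u v : seq letter) N : reduced u -> reduced v ->
  N + size v <= size u -> take N (mulw u v) = take N u.
Proof.
elim: v u => [|a v IHv] u ru rav /= le_uv; first by rewrite mulws0.
have rv : reduced v by move: rav; rewrite reduced_cons => /andP[].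
have -> : a :: v = mulw [:: a] v by rewrite -(push_cons rav).
rewrite mulwA// addnS in le_uv *.
have ra : reduced (mulw u [:: a]) by apply: mulw_reduced.
have [eu|[u' eu eu']] := mulw_letter a ru.
  rewrite IHv// eu ?size_rcons; last by apply: leq_trans (ltnW le_uv) _.
  by rewrite -cats1 takel_cat// (leq_trans (leq_addr _ _) (ltnW le_uv)).
rewrite IHv// eu'; rewrite eu size_rcons ltnS in le_uv => //.
by rewrite eu -cats1 takel_cat// (leq_trans (leq_addr _ _) le_uv).
Qed.

Lemma aut_lipschitz (phi : autF2) :
  exists C, forall x : F2, size (phi x) <= C * size x.
Proof.
pose C := \max_(a : letter) size (phi (F2_letter a)).
exists C => x; have phi1 : phi 1 = 1.
  by apply: (mulgI (phi 1)); rewrite -aut_morph !mulg1.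
elim/F2_elim: x => [|a x rx IHx]; first by rewrite phi1.
rewrite aut_morph (leq_trans (size_mulw _ _))//.
have -> : word (F2_letter a * x) = a :: x by rewrite /= push_cons.
by rewrite mulnS leq_add//; apply: leq_bigmax.
Qed.

Lemma aut_proper (phi : autF2) L :
  exists M, forall x : F2, M <= size x -> L <= size (phi x).
Proof.
have [C psiC] := aut_lipschitz (phi^-1).
exists (C * L).+1 => x ltx; rewrite leqNgt; apply/negP => ltL.
have := psiC (phi x); rewrite /= (aut_funK phi x) => lex.
have := leq_trans ltx lex; rewrite ltnNge leq_mul2l ltnW ?orbT//.
Qed.

Lemma aut_prefix (phi : autF2) N : exists M, forall u x : F2,
  M <= size u -> prefix u x ->
  take N (phi x) = take N (phi u) /\ N <= size (phi u).
Proof.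
have [C phiC] := aut_lipschitz phi.
have [M phiM] := aut_proper phi (N + C).
exists M => u [w rw] leu /= /prefixP[t ew]; subst w.
split; last by apply: leq_trans (leq_addr _ _) (phiM _ leu).
elim/last_ind: t rw => [|t a IHt] rw.
  by congr (take N (phi _)); apply/val_inj => /=; rewrite cats0.
have rt : reduced (u ++ t).
  by move: rw; rewrite -rcons_cat -cats1 => /cat_sorted2[].
rewrite (_ : ReducedWord rw = ReducedWord rt * F2_letter a); last first.
  by apply/val_inj; rewrite /= mulw_cat -catA cats1.
rewrite aut_morph take_mulw ?IHt ?wordP//.
apply: leq_trans (phiM _ _); last first.
  by rewrite /= size_cat (leq_trans leu)// leq_addr.
by rewrite leq_add2l (leq_trans (phiC _))//= muln1.
Qed.

Lemma boundary_mapP (phi : autF2) (X : boundary) :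
  tends_to (fun k => phi (trunc X k)) (boundary_map phi X).
Proof.
suff [Z ZP] : exists Z, tends_to (fun k => phi (trunc X k)) Z.
  by apply: xgetPex; exists Z.
pose M n := projT1 (cid (aut_prefix phi n)).
have MP n k : M n <= k ->
    take n (phi (trunc X k)) = take n (phi (trunc X (M n))) /\
    n <= size (phi (trunc X (M n))).
  move=> le_k; apply: (projT2 (cid (aut_prefix phi n))).
    by rewrite size_mkseq.
  by rewrite /= prefixE size_mkseq take_mkseq.
apply: (tends_to_ex (M := M)) => [n k /MP[-> _]//|n].
by rewrite size_takel//; have [] := MP n _ (leqnn _).
Qed.

Lemma boundary_map_unif (phi : autF2) N : exists M, forall (X : boundary) k,
  M <= k -> word (trunc (boundary_map phi X) N) = take N (phi (trunc X k)).
Proof.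
have [M phiM] := aut_prefix phi N; exists M => X k lek.
have /tends_toP/(_ N)[K XK] := boundary_mapP phi X.
rewrite -(XK _ (leq_maxl K k)).
have := phiM (trunc X k) (trunc X (maxn K k)).
rewrite /= size_mkseq prefixE size_mkseq take_mkseq ?leq_maxr// eqxx.
by move=> /(_ lek isT)[].
Qed.

Lemma boundary_map_continuous (phi : autF2) : continuous (boundary_map phi).
Proof.
move=> X A /nbhs_boundaryE[N NA]; apply/nbhs_boundaryE.
have [M phiM] := boundary_map_unif phi N; exists M => Y.
rewrite /cylinder/= size_mkseq => YX; apply: NA.
rewrite /cylinder/= size_mkseq; have /= := phiM Y M (leqnn _).
by rewrite [trunc Y M](_ : _ = trunc X M) => [->|]; [rewrite -phiM|apply/val_inj].
Qed.

Lemma boundary_map1 (X : boundary) : boundary_map 1 X = X.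
Proof.
apply: tends_to_unique (boundary_mapP _ _) _; apply/tends_toP => n.
by exists n => k nk /=; rewrite take_mkseq.
Qed.

Lemma boundary_mapM (phi psi : autF2) (X : boundary) :
  boundary_map (phi * psi) X = boundary_map phi (boundary_map psi X).
Proof.
apply: tends_to_unique (boundary_mapP _ _) _; apply/tends_toP => N.
have [M phiM] := aut_prefix phi N; have [M' phiM'] := boundary_map_unif phi N.
pose m := maxn M M'; have [K psiK] := boundary_map_unif psi m.
exists K => k lek; rewrite (phiM' _ m (leq_maxr _ _)).
apply: (proj1 (phiM _ _ _ _)); first by rewrite /= size_mkseq leq_maxl.
by rewrite (psiK X k lek) prefix_take.
Qed.

Lemma boundary_mapK (phi : autF2) :
  cancel (boundary_map phi) (boundary_map phi^-1).
Proof. by move=> X; rewrite -boundary_mapM mulVg boundary_map1. Qed.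

Definition parabolic_orbit (phi : autF2) : Prop :=
  exists X Y : boundary, [/\ X <> Y,
    (fun k => boundary_map (phi ^+ k) Y) @ \oo --> X &
    (fun k => boundary_map (phi ^- k) Y) @ \oo --> X].

(* Main.v *)
(* Let [phi] have a parabolic orbit at [X], and let [X_i] be the prefixes of
   [X]. If [phi] had no nontrivial fixed element, the words [X_i^-1 phi(X_i)]
   would be pairwise distinct, so that [|phi(X_i)| - i] would tend to an
   infinity. By bounded cancellation, [+oo] makes [X] attracting, which is
   impossible since [phi^-k Y] tends to [X]; so it is [-oo], and likewise for
   [phi^-1], which is absurd because [phi^-1 (phi X_i) = X_i]. Hence [phi] fixes
   some [g <> 1], and the limits of [g^n] and [g^-n] are fixed by [phi]; one of
   them, [P], is not [X].
   Every automorphism of F_2 is induced by a homeomorphism of a once-punctured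
   torus, so it preserves or reverses the cyclic order on the boundary given by
   the ribbon structure of the rose: Nielsen's generators and the inner
   automorphisms do, and the Nielsen reduction of a basis shows that they
   suffice. Now [phi^2] fixes [X] and [P] and preserves the cyclic order, so it
   moves [Y] monotonically in one of the two intervals between [X] and [P], and
   the orbit can converge to [X] in at most one direction of time. *)
From HB Require Import structures.
From mathcomp Require Import all_boot.
From mathcomp Require Import zify.
From mathcomp Require Import all_classical topology.
Require Import Defs.

Set Implicit Arguments.
Unset Strict Implicit.
Unset Printing Implicit Defensive.

Local Open Scope group_scope.

Implicit Types u v w : seq letter.

(** * Longest common prefixes and word length *)

Fixpoint lcp (u v : seq letter) : nat :=
  match u, v with
  | a :: u', b :: v' => if a == b then (lcp u' v').+1 else 0
  | _, _ => 0
  end.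

Lemma leq_lcp u v n :
  (n <= lcp u v) = [&& n <= size u, n <= size v & take n u == take n v].
Proof.
elim: u v n => [|a u IHu] [|b v] [|n] //=; first by rewrite andbF.
by rewrite eqseq_cons; case: eqP => // _; rewrite ?andbF// ltnS IHu.
Qed.

Lemma lcpC u v : lcp u v = lcp v u.
Proof. by elim: u v => [|a u IHu] [|b v] //=; rewrite eq_sym IHu. Qed.

Lemma lcp_sizel u v : lcp u v <= size u.
Proof. by have := leqnn (lcp u v); rewrite leq_lcp => /and3P[]. Qed.

Lemma lcp_sizer u v : lcp u v <= size v.
Proof. by rewrite lcpC lcp_sizel. Qed.

Lemma lcp_take u v n : n <= lcp u v -> take n u = take n v.
Proof. by rewrite leq_lcp => /and3P[_ _ /eqP]. Qed.

Lemma lcp_trans u v w n : n <= lcp u v -> n <= lcp v w -> n <= lcp u w.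
Proof. by rewrite !leq_lcp => /and3P[-> _ /eqP->] /and3P[_ -> ->]. Qed.

(** [lcp] is the Gromov product at the root of the Cayley tree, hence ultrametric: the two smallest
    of three values coincide. *)
Lemma lcp_isosceles u v w : lcp u v < lcp v w -> lcp u w = lcp u v.
Proof.
move=> lt_uv; apply/eqP; rewrite eqn_leq; apply/andP; split; last first.
  by apply: lcp_trans (ltnW lt_uv).
rewrite leqNgt; apply/negP => lt_uw.
suff : lcp u v < lcp u v by rewrite ltnn.
by apply: lcp_trans lt_uw _; rewrite (lcpC w).
Qed.

Lemma lcp_takel u m : lcp (take m u) u = minn m (size u).
Proof.
elim: u m => [|a u IHu] [|m] //=; try lia.
by rewrite eqxx IHu; lia.
Qed.

Lemma lcp_take2 u m n : lcp (take m u) (take n u) = minn (minn m n) (size u).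
Proof.
elim: u m n => [|a u IHu] [|m] [|n] //=; try lia.
by rewrite eqxx IHu; lia.
Qed.

Lemma size_invw u : size (invw u) = size u.
Proof. by rewrite size_rev size_map. Qed.

(** Exactly the common prefix cancels in [u^-1 v], so [lcp] computes distances in the Cayley
    tree. *)
Lemma size_divw u v : reduced u -> reduced v ->
  size (mulw (invw u) v) + (lcp u v).*2 = size u + size v.
Proof.
elim: u v => [|a u IHu] [|b v] ru rv.
- by [].
- by rewrite /= addn0.
- by rewrite mulws0 ?invw_reduced// size_invw.
rewrite /=; case: eqP => [eab|/eqP nab].
  subst b; have -> : mulw (invw (a :: u)) (a :: v) = mulw (invw u) v.
    rewrite /invw /= rev_cons -cats1 /mulw foldr_cat /=.
    by rewrite letter_invK eqxx.
  have := IHu v; rewrite !reduced_cons in ru rv.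
  by move: ru rv => /andP[_ ru] /andP[_ rv] /(_ ru rv); lia.
rewrite mulw_cat ?size_cat ?size_invw ?addn0//.
have := invw_reduced ru; rewrite {1}/invw /= rev_cons -/(invw u).
have <- : rcons (invw u) (letter_inv a) = invw (a :: u).
  by rewrite /invw /= rev_cons.
rewrite /reduced; case: (rcons _ _) (last_rcons a (invw u) (letter_inv a)) =>
  //=.
move=> c s lcs pcs; rewrite cat_path pcs /=; move: rv => /= ->.
by rewrite lcs letter_invK eq_sym nab.
Qed.

Implicit Types (x y z g h : F2) (phi psi : autF2) (X Y Z U V W : boundary).

Lemma size_F2_div x y : size (x^-1 * y) + (lcp x y).*2 = size x + size y.
Proof. exact: size_divw (wordP x) (wordP y). Qed.

Lemma size_F2V x : size x^-1 = size x.
Proof. exact: size_invw. Qed.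

Lemma size_F2M x y : size (x * y) <= size x + size y.
Proof. exact: size_mulw. Qed.

Lemma size_F2_eq0 x : (size x == 0) = (x == 1).
Proof. by rewrite size_eq0 -val_eqE. Qed.

Lemma autF2_1 phi : phi 1 = 1.
Proof. by apply: (mulgI (phi 1)); rewrite -aut_morph !mulg1. Qed.

Lemma autF2V phi x : phi x^-1 = (phi x)^-1.
Proof. by apply: (mulgI (phi x)); rewrite -aut_morph !mulgV autF2_1. Qed.

Lemma autF2_inj phi : injective phi.
Proof. exact: bij_inj (aut_bij phi). Qed.

(** * Bounded cancellation *)

Lemma aut_lip phi :
  exists2 C, 0 < C & forall x, size (phi x) <= (C * size x)%N.
Proof.
have [C phiC] := aut_lipschitz phi; exists C.+1 => // x.
by apply: leq_trans (phiC x) _; rewrite leq_mul2r leqnSn orbT.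
Qed.

Lemma pfx_subproof x n : reduced (take n x).
Proof. exact: take_sorted (wordP x). Qed.

Definition pfx x n : F2 := ReducedWord (pfx_subproof x n).

Lemma size_pfx_div x i j : i <= size x -> j <= size x ->
  size ((pfx x i)^-1 * pfx x j) = (i - j) + (j - i).
Proof.
move=> ix jx; have := size_F2_div (pfx x i) (pfx x j).
rewrite [word (pfx x i)]/= [word (pfx x j)]/= lcp_take2 !size_takel//; lia.
Qed.

Lemma size_pfx_step x i j : i <= j.+1 -> j <= i.+1 ->
  size ((pfx x i)^-1 * pfx x j) <= 1.
Proof.
move=> ij ji; have := size_F2_div (pfx x i) (pfx x j).
by rewrite [word (pfx x i)]/= [word (pfx x j)]/= lcp_take2 !size_take_min; lia.
Qed.

(** Right multiplication by an element of length at most [C] keeps the first [N] letters of a word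
    of length at least [N + C]. So the prefix can change only after a visit to a shorter word. *)
Lemma path_escape (w : nat -> F2) C N n :
  (forall i, size ((w i)^-1 * w i.+1) <= C) -> N <= size (w 0) ->
  take N (w n) <> take N (w 0) ->
  exists i, [/\ i <= n, take N (w i) = take N (w 0) & size (w i) < N + C].
Proof.
elim: n w => [|n IHn] w wC Nw wn; first by [].
case: (ltnP (size (w 0)) (N + C)) => [lt|ge]; first by exists 0.
have w1 : take N (w 1%N) = take N (w 0).
  rewrite -[w 1%N](mulVKg (w 0)) take_mulw ?wordP//.
  by apply: leq_trans ge; rewrite leq_add2l wC.
have [||i [ile wi ltw]] := IHn (fun i => w i.+1) (fun i => wC i.+1).
- rewrite leqNgt; apply/negP => lt1.
  by have := congr1 size w1; rewrite !size_take_min; lia.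
- by rewrite w1.
by exists i.+1; rewrite -w1.
Qed.

(* If the path [phi (pfx x i)] left the cylinder of the first [N] letters of
   [phi (pfx x m)], it would pass near the end of that prefix both before and
   after time [m], at times close to [m] since [phi^-1] is Lipschitz. *)
Lemma bounded_cancellation phi :
  exists C, forall x m, m <= size x ->
    let N := size (phi (pfx x m)) - C in
    take N (phi x) = take N (phi (pfx x m)).
Proof.
have [C0 C0gt0 phiC] := aut_lip phi.
have [C1 C1gt0 psiC] := aut_lip phi^-1.
pose D := (C1 * C0.*2)%N; exists (C0 + C0 * D).+1 => x m mx N.
case: (posnP N) => [->|N0]; first by rewrite !take0.
apply: contrapT => nex.
have step i j : i <= j.+1 -> j <= i.+1 ->
    size ((phi (pfx x i))^-1 * phi (pfx x j)) <= C0.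
  move=> ij ji; rewrite -autF2V -aut_morph (leq_trans (phiC _))//.
  by rewrite -[leqRHS]muln1 leq_mul2l size_pfx_step ?orbT.
have Nm : N <= size (phi (pfx x m)) by rewrite /N leq_subr.
have [|||i [ile]] :=
    @path_escape (fun i => phi (pfx x (m + i))) C0 N (size x - m).
- by move=> i; apply: step; lia.
- by rewrite addn0.
- rewrite addn0 subnKC//; suff -> : pfx x (size x) = x by [].
  by apply/val_inj; rewrite /= take_size.
rewrite addn0 => ti lti.
(* Run backwards, the path ends at [phi 1 = 1], which lacks the prefix because [0 < N]. *)
have [|||j [jle]] := @path_escape (fun i => phi (pfx x (m - i))) C0 N m.
- by move=> j; apply: step; lia.
- by rewrite subn0.
- rewrite subn0 subnn; have -> : pfx x 0 = 1 by apply/val_inj; rewrite /= take0.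
  rewrite autF2_1 => /(congr1 size); rewrite !size_take_min /=; lia.
rewrite subn0 => tj ltj.
have dij : size ((phi (pfx x (m - j)))^-1 * phi (pfx x (m + i))) <= C0.*2.
  have := size_F2_div (phi (pfx x (m - j))) (phi (pfx x (m + i))).
  suff : N <= lcp (phi (pfx x (m - j))) (phi (pfx x (m + i))) by lia.
  rewrite leq_lcp ti tj eqxx andbT.
  have := congr1 size ti; have := congr1 size tj.
  by rewrite !size_take_min; lia.
(* Applying [phi^-1] bounds the distance [i + j] between the two prefixes of [x]. *)
have ltD : i <= D.
  have := psiC ((phi (pfx x (m - j)))^-1 * phi (pfx x (m + i))).
  rewrite -autF2V -aut_morph /= (aut_funK phi) aut_morph autF2V.
  rewrite -[size (mulw _ _)]/(size ((pfx x (m - j))^-1 * pfx x (m + i))).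
  rewrite size_pfx_div; [|lia|lia] => le.
  apply: leq_trans (leq_trans le (leq_mul (leqnn C1) dij)).
  by lia.
(* Returning from time [m + i] to [m] adds at most [C0 * D] letters, so [phi (pfx x m)] is shorter
   than [N + C0 + C0 * D], against the choice of [N]. *)
have : size (phi (pfx x m)) <= size (phi (pfx x (m + i))) + C0 * D.
  rewrite -[X in phi X](mulVKg (pfx x (m + i))) aut_morph.
  rewrite (leq_trans (size_F2M _ _))// leq_add2l (leq_trans (phiC _))//.
  rewrite leq_mul2l size_pfx_div; [|lia|lia].
  by apply/orP; right; lia.
by move: lti N0; rewrite /N; clear; lia.
Qed.

(** * Fixed elements of automorphisms with a parabolic orbit *)

Lemma size_trunc X n : size (trunc X n) = n.
Proof. exact: size_mkseq. Qed.

Lemma pfx_trunc X m n : m <= n -> pfx (trunc X n) m = trunc X m.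
Proof. by move=> mn; apply/val_inj; rewrite /= take_mkseq. Qed.

Lemma trunc_inj X Y : (forall n, exists2 m, n <= m & trunc X m = trunc Y m) ->
  X = Y.
Proof.
move=> XY; apply: eq_boundary => n; have [m nm /(congr1 (@word))/= e] := XY n.
by rewrite -(take_mkseq _ nm) e take_mkseq.
Qed.

Lemma trunc_leq X Y m n : m <= n -> trunc X n = trunc Y n ->
  trunc X m = trunc Y m.
Proof. by move=> mn e; rewrite -!(pfx_trunc _ mn) e. Qed.

Lemma boundary_prefix phi : exists C, forall X i,
  let N := size (phi (trunc X i)) - C in
  word (trunc (boundary_map phi X) N) = take N (phi (trunc X i)).
Proof.
have [C phiC] := bounded_cancellation phi; exists C => X i N.
have [M phiM] := boundary_map_unif phi N.
rewrite (phiM X (maxn M i)) ?leq_maxl//.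
have := phiC (trunc X (maxn M i)) i.
by rewrite size_trunc leq_maxr pfx_trunc ?leq_maxr//; apply.
Qed.

Lemma boundary_map_trunc phi N : exists M, forall X Y,
  trunc X M = trunc Y M ->
  trunc (boundary_map phi X) N = trunc (boundary_map phi Y) N.
Proof.
have [M phiM] := boundary_map_unif phi N; exists M => X Y e.
apply/val_inj; apply: etrans (phiM X M (leqnn _)) _.
by rewrite e -(phiM Y M (leqnn _)).
Qed.

Definition converges (u : nat -> boundary) X :=
  forall n, exists K, forall k, K <= k -> trunc (u k) n = trunc X n.

Lemma cvg_converges (u : nat -> boundary) X :
  cvg_to (nbhs (u @ \oo)%classic) (nbhs X) -> converges u X.
Proof.
move=> uX n; have : nbhs X (cylinder (trunc X n)).
  by apply/nbhs_boundaryE; exists n.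
move=> /uX[K _ uK]; exists K => k Kk; apply/val_inj.
by have := uK k Kk; rewrite /cylinder /= size_mkseq.
Qed.

Lemma converges_cst X Y : converges (fun=> Y) X -> X = Y.
Proof.
move=> YX; apply: trunc_inj => n; exists n => //.
by have [K /(_ K (leqnn K))] := YX n.
Qed.

Lemma converges_fixed phi X Y :
  converges (fun k => boundary_map (phi ^+ k) Y) X -> boundary_map phi X = X.
Proof.
move=> cX; apply: converges_cst => n.
have [M phiM] := boundary_map_trunc phi n.
have [K XK] := cX M; have [L XL] := cX n.
exists 0 => _ _; pose k := maxn K L.
rewrite -(XL k.+1) ?expgS ?boundary_mapM; last by rewrite /k; lia.
by apply: phiM; apply: XK; rewrite /k; lia.
Qed.

(** Under the refuted condition, [phi ^+ k] maps the cylinder of length [I] around [X] into that of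
    length [k + I]. For large [k] the former contains the image of [Y] under [phi ^- k], so the
    latter contains [Y]. *)
Lemma not_attracting phi X Y : X <> Y ->
  converges (fun k => boundary_map (phi ^- k) Y) X -> forall I,
  ~ (forall i Z, I <= i -> trunc Z i = trunc X i ->
     trunc (boundary_map phi Z) i.+1 = trunc X i.+1).
Proof.
move=> nXY cX I att; apply: nXY; apply: trunc_inj => n.
have [K XK] := cX I; pose k := maxn K n.
exists (k + I); first by rewrite /k; lia.
have attj j Z : trunc Z I = trunc X I ->
    trunc (boundary_map (phi ^+ j) Z) (j + I) = trunc X (j + I).
  move=> ZX; elim: j => [|j IHj]; first by rewrite expg0 boundary_map1.
  by rewrite expgS boundary_mapM att// leq_addl.
rewrite -(attj k (boundary_map (phi ^- k) Y)) ?XK ?leq_maxl//.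
by rewrite -boundary_mapM mulgV boundary_map1.
Qed.

(** Equal displacements at [i] and [j] make [trunc X j * (trunc X i)^-1] a fixed element, so
    displacements are distinct, while only finitely many words have length at most [R]. *)
Lemma displacement_unbounded phi X : (forall g, phi g = g -> g = 1) ->
  forall R, exists I, forall i, I <= i ->
    R < size ((trunc X i)^-1 * phi (trunc X i)).
Proof.
move=> nofix R; pose d i := (trunc X i)^-1 * phi (trunc X i).
have d_inj : injective d.
  move=> i j dij.
  have : phi (trunc X j * (trunc X i)^-1) = trunc X j * (trunc X i)^-1.
    have dE k : phi (trunc X k) = trunc X k * d k by rewrite mulVKg.
    by rewrite aut_morph autF2V !dE dij invgM mulgA mulgK.
  move=> /nofix /(canRL (mulgVK _)); rewrite mul1g => e.
  by rewrite -(size_trunc X i) -(size_trunc X j) e.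
apply: contrapT => nI.
have next I : exists2 i, I <= i & size (d i) <= R.
  apply: contrapT => nex; apply: nI; exists I => i Ii; rewrite ltnNge.
  by apply/negP => le; apply: nex; exists i.
have big n : exists s,
    [/\ uniq s, size s = n & all (fun i => size (d i) <= R) s].
  elim: n => [|n [s [us ss sR]]]; first by exists [::].
  have [i si di] := next (\max_(j <- s) j).+1.
  exists (i :: s); rewrite /= us ss di sR; split => //; rewrite andbT.
  apply/negP => is_; have : i <= \max_(j <- s) j.
    exact: (@leq_bigmax_seq _ s predT (fun j => j)).
  by rewrite leqNgt si.
have [s [us ss sR]] := big #|{: R.-bseq letter}|.+1.
pose f i : R.-bseq letter := insub_bseq R (d i).
have fK i : i \in s -> val (f i) = d i.
  by move=> /(allP sR) di; rewrite /f /insub_bseq insubdK.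
have : size (map f s) <= #|{: R.-bseq letter}|.
  rewrite -(card_uniqP _) ?max_card// map_inj_in_uniq//.
  move=> i j si sj fij; apply: d_inj; apply/val_inj.
  by rewrite -[LHS]fK// fij fK.
by rewrite size_map ss ltnn.
Qed.

Lemma fixed_ray phi X : boundary_map phi X = X -> exists C, forall i,
  take (size (phi (trunc X i)) - C) (phi (trunc X i)) =
  trunc X (size (phi (trunc X i)) - C).
Proof.
move=> phiX; have [C phiC] := boundary_prefix phi; exists C => i.
by rewrite -phiC phiX.
Qed.

Lemma parabolic_shrinks phi X Y : (forall g, phi g = g -> g = 1) -> X <> Y ->
  boundary_map phi X = X -> converges (fun k => boundary_map (phi ^- k) Y) X ->
  forall B, exists I, forall i, I <= i -> size (phi (trunc X i)) + B <= i.
Proof.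
move=> nofix nXY phiX cX B.
have [C phiC] := boundary_prefix phi.
have [C0 _ lip] := aut_lip phi.
pose L i := size (phi (trunc X i)).
have [I XI] := displacement_unbounded X nofix (B + C0 + C.*2 + C).
(* As [X] is fixed, [trunc X i] and its image share [minn i (L i - C)] letters; a large displacement
   then forces a large gap between [i] and [L i]. *)
have far i : I <= i -> i + (B + C0 + C) < L i \/ L i + (B + C0 + C) < i.
  move=> /XI; have := size_F2_div (trunc X i) (phi (trunc X i)).
  have : minn i (L i - C) <= lcp (trunc X i) (phi (trunc X i)).
    rewrite leq_lcp size_trunc geq_minl -/(L i).
    rewrite (leq_trans (geq_minr _ _) (leq_subr _ _)) /=.
    rewrite -[X in _ == X](@take_takel _ _ (L i - C)) ?geq_minr// -phiC phiX.
    by rewrite /= !take_mkseq ?geq_minl ?geq_minr.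
  by rewrite size_trunc -/(L i); lia.
(* [L] varies too slowly to jump over the gap, so the alternative holding at [I] persists. *)
have step i : L i.+1 <= L i + C0 /\ L i <= L i.+1 + C0.
  pose v := (trunc X i)^-1 * trunc X i.+1.
  have lev : size v <= 1.
    have := @size_pfx_step (trunc X i.+1) i i.+1.
    by rewrite !pfx_trunc//; apply; lia.
  have phiv : size (phi v) <= C0.
    by rewrite (leq_trans (lip _))// -[leqRHS]muln1 leq_mul2l lev orbT.
  have e : trunc X i.+1 = trunc X i * v by rewrite mulVKg.
  split; first by rewrite /L e aut_morph (leq_trans (size_F2M _ _))// leq_add2l.
  have -> : L i = size (phi (trunc X i.+1) * (phi v)^-1).
    by rewrite e aut_morph mulgK.
  by rewrite (leq_trans (size_F2M _ _))// size_F2V leq_add2l.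
case: (far I (leqnn I)) => [grow|shrink].
  (* In the growing case, bounded cancellation gives the image of a ray through [trunc X i] the
     first [L i - C > i] letters of [X]. *)
  exfalso; apply: (not_attracting nXY cX (I := I)) => i Z Ii Zi.
  have LI : i + (B + C0 + C) < L i.
    elim: i Ii {Zi} => [|i IHi]; first by rewrite leqn0 => /eqP <-.
    rewrite leq_eqVlt => /orP[/eqP<-//|Ii].
    have [] := far i.+1 (ltnW Ii); have [] := step i; have := IHi Ii; lia.
  apply: (@trunc_leq _ _ _ (L i - C)); first by lia.
  apply/val_inj; transitivity (take (L i - C) (phi (trunc X i))).
    by rewrite /L -Zi; apply: phiC.
  by rewrite /L -phiC phiX.
exists I; elim => [|i IHi].
  by rewrite leqn0 => /eqP e; move: shrink; rewrite e -/(L 0); lia.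
rewrite leq_eqVlt => /orP[/eqP<-//|Ii]; first by rewrite -/(L I); lia.
have [] := far i.+1 (ltnW Ii); have [] := step i; have := IHi Ii;
  by rewrite -!/(L _); lia.
Qed.

Lemma parabolic_fixes phi X Y : X <> Y ->
  converges (fun k => boundary_map (phi ^+ k) Y) X ->
  converges (fun k => boundary_map (phi ^- k) Y) X ->
  exists2 g, g <> 1 & phi g = g.
Proof.
move=> nXY cX cVX; apply: contrapT => nex.
have nofix g : phi g = g -> g = 1.
  by move=> phig; apply: contrapT => g1; apply: nex; exists g.
have nofixV g : phi^-1 g = g -> g = 1.
  by move=> phig; apply: nofix; rewrite -{1}phig; apply: aut_inv_funK.
have phiX := converges_fixed cX.
have phiVX : boundary_map phi^-1 X = X by rewrite -{1}phiX boundary_mapK.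
have [C1 _ lip] := aut_lip phi^-1; have [C ray] := fixed_ray phiX.
pose B := (C1 * C).+1.
have [I shr] := parabolic_shrinks nofix nXY phiX cVX B.
have [|I' shrV] := parabolic_shrinks nofixV nXY phiVX _ B.
  by move=> n; have [K XK] := cX n; exists K => k /XK; rewrite expVgn invgK.
have [M phiM] := aut_proper phi (I' + C).
(* Up to a remainder [w] of length at most [C], the image of [trunc X i] is [trunc X m], so
   [phi^-1 (trunc X m)] has length at least [i - C1 * C]. But shrinking gives [m < i] and bounds
   that length by [m - B], where [B > C1 * C]. The choice of [M] ensures [I' <= m]. *)
pose i := maxn I M; pose m := size (phi (trunc X i)) - C.
have Lm : size (phi (trunc X i)) = m + C.
  by have := phiM (trunc X i); rewrite size_trunc leq_maxr /m => /(_ isT); lia.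
pose w := (trunc X m)^-1 * phi (trunc X i).
have lew : size w <= C.
  have := size_F2_div (trunc X m) (phi (trunc X i)).
  have : m <= lcp (trunc X m) (phi (trunc X i)).
    by rewrite -ray lcp_takel -/m Lm; lia.
  by rewrite size_trunc Lm -/w; lia.
have Xi : trunc X i = phi^-1 (trunc X m) * phi^-1 w.
  by rewrite -aut_morph mulVKg [RHS]aut_funK.
have : i <= size (phi^-1 (trunc X m)) + C1 * C.
  rewrite -{1}(size_trunc X i) Xi (leq_trans (size_F2M _ _))// leq_add2l.
  by rewrite (leq_trans (lip _))// leq_mul2l lew orbT.
have := shr i (leq_maxl _ _).
have /shrV : I' <= m.
  by have := phiM (trunc X i); rewrite size_trunc leq_maxr Lm => /(_ isT); lia.
by rewrite Lm /B; lia.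
Qed.

(** * The action of the free group on its boundary *)

Lemma mkseqS T (f : nat -> T) n : mkseq f n.+1 = f 0 :: mkseq (f \o S) n.
Proof. by rewrite /mkseq /= (iotaDl 1 0 n) -map_comp. Qed.

Definition push_fun a X n :=
  if X 0 == letter_inv a then X n.+1 else if n is n'.+1 then X n' else a.

Lemma push_fun_subproof a X n :
  push_fun a X n.+1 != letter_inv (push_fun a X n).
Proof.
rewrite /push_fun; case: ifP => [_|/negbT nX]; first exact: inf_wordP.
by case: n => //= n; apply: inf_wordP.
Qed.

Definition bpush a X : boundary := InfWord (push_fun_subproof a X).

Definition act (g : seq letter) X : boundary := foldr bpush X g.

Lemma tends_to_trunc X : tends_to (trunc X) X.
Proof. by apply/tends_toP => n; exists n => k nk; rewrite /= take_mkseq. Qed.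

Lemma tends_to_push a (u : nat -> F2) X :
  tends_to u X -> tends_to (fun k => F2_letter a * u k) (bpush a X).
Proof.
move=> /tends_toP uX; apply/tends_toP => n.
have [K XK] := uX n.+1; exists K => k /XK /= uE.
have uEn : take n (u k) = mkseq X n.
  by rewrite -(@take_takel _ n n.+1)// uE take_mkseq.
move: uE uEn; rewrite /push; case: (word (u k)) => [|b t] //.
rewrite mkseqS /= => -[-> tE] uEn.
rewrite /bpush /push_fun; case: eqP => _ //.
case: n uEn {XK tE} => //= n uEn; rewrite mkseqS /=; congr (_ :: _).
transitivity (take n (mkseq X n.+1)); last by rewrite take_mkseq.
by rewrite -uEn -[X 0 :: take n t]/(take n.+1 (X 0 :: t)) take_takel.
Qed.

Lemma tends_to_act g (u : nat -> F2) X :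
  tends_to u X -> tends_to (fun k => g * u k) (act g X).
Proof.
move=> uX; elim/F2_elim: g => [|a g rag IHg].
  by under eq_fun do rewrite mul1g.
under eq_fun do rewrite -mulgA.
have -> : act (F2_letter a * g) X = bpush a (act g X).
  by rewrite /act /= push_cons.
exact: tends_to_push.
Qed.

Lemma tends_to_size (u : nat -> F2) X n : tends_to u X ->
  exists K, forall k, K <= k -> n <= size (u k).
Proof.
move=> /tends_toP/(_ n)[K XK]; exists K => k /XK /(congr1 size).
by rewrite size_take_min size_mkseq; lia.
Qed.

Lemma tends_to_mulr (u : nat -> F2) X h :
  tends_to u X -> tends_to (fun k => u k * h) X.
Proof.
move=> uX; apply/tends_toP => n.
have [K uK] := tends_to_size (n + size h) uX.
have /tends_toP/(_ n)[L uL] := uX.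
exists (maxn K L) => k; rewrite geq_max => /andP[/uK nu /uL <-].
by apply: take_mulw; rewrite ?wordP.
Qed.

Lemma tends_to_map phi (u : nat -> F2) X :
  tends_to u X -> tends_to (phi \o u) (boundary_map phi X).
Proof.
move=> uX; apply/tends_toP => n.
have [M phiM] := aut_prefix phi n; have [N phiN] := boundary_map_unif phi n.
have /tends_toP/(_ (maxn M N))[K uK] := uX.
exists K => k /uK uE; rewrite (phiN X (maxn M N) (leq_maxr _ _)).
apply: (phiM _ _ _ _).1; first by rewrite size_mkseq leq_maxl.
by rewrite -uE prefix_take.
Qed.

(** Both sides are limits of the same sequence in [F2]; this replaces a case analysis of
    cancellations. *)
Lemma actM g h X : act (g * h) X = act g (act h X).
Proof.
apply: tends_to_unique (tends_to_act _ (tends_to_trunc X)) _.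
under eq_fun do rewrite -mulgA.
by do 2![apply: tends_to_act]; apply: tends_to_trunc.
Qed.

Lemma actK g X : act g^-1 (act g X) = X.
Proof. by rewrite -actM mulVg. Qed.

Lemma boundary_map_act phi g X :
  boundary_map phi (act g X) = act (phi g) (boundary_map phi X).
Proof.
apply: tends_to_unique (tends_to_map _ (tends_to_act _ (tends_to_trunc X))) _.
rewrite (_ : _ \o _ = fun k => phi g * phi (trunc X k)).
  exact/tends_to_act/boundary_mapP.
by apply/funext => k /=; rewrite aut_morph.
Qed.

Lemma inner_morph g : {morph (fun x => g * x * g^-1) : x y / x * y}.
Proof. by move=> x y; rewrite !mulgA mulgVK. Qed.

Lemma inner_bij g : bijective (fun x => g * x * g^-1).
Proof.
by exists (fun x => g^-1 * x * g) => x; rewrite !mulgA ?mulgVK ?mulVg ?mulgK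
  ?mulgV mul1g// ?mulgVK ?mulgK.
Qed.

Definition inner g : autF2 := AutF2 (@inner_morph g) (@inner_bij g).

Lemma boundary_map_inner g X : boundary_map (inner g) X = act g X.
Proof.
apply: tends_to_unique (boundary_mapP _ _) _.
exact/tends_to_mulr/tends_to_act/tends_to_trunc.
Qed.

Lemma act_head a w X : reduced (a :: w) -> X 0 != letter_inv (last a w) ->
  act (a :: w) X 0 = a.
Proof.
elim: w a => [|b w IHw] a rw Xn.
  by rewrite /= /push_fun; move: Xn => /= /negbTE ->.
have /andP[nba rbw] : (b != letter_inv a) && reduced (b :: w) by [].
rewrite -[LHS]/(push_fun a (act (b :: w) X) 0) /push_fun IHw//.
by rewrite (negbTE nba).
Qed.

Lemma act_local w n X Y : (forall i, i < n + size w -> X i = Y i) ->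
  forall i, i < n -> act w X i = act w Y i.
Proof.
elim: w n => [|a w IHw] n XY i lt_in.
  by apply: XY; rewrite addn0.
have XY' j : j < n.+1 -> act w X j = act w Y j.
  by apply: IHw => k; rewrite addSnnS; apply: XY.
rewrite /= /push_fun -!/(act w _) XY'//; case: ifP => _; first by rewrite XY'.
by case: i lt_in => //= i lt_in; rewrite XY'//; lia.
Qed.

Lemma F2_word_inj x y : word x = word y -> x = y.
Proof. exact: val_inj. Qed.

(** The condition on the end letters lets copies of [x] be concatenated without cancellation, so the
    limit is the periodic word [f]. *)
Lemma cyclically_reduced_limit x a w : word x = a :: w ->
  a != letter_inv (last a w) ->
  exists2 P : boundary, P 0 = a & tends_to (fun n => x ^+ n) P.
Proof.
move=> xE nal; pose p := (size w).+1; pose f n := nth a (a :: w) (n %% p).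
have fP n : f n.+1 != letter_inv (f n).
  have lt_np : n %% p < p by rewrite ltn_mod.
  have rx := wordP x; rewrite xE in rx.
  case: (ltnP (n %% p).+1 p) => [lt|ge].
    have e : n.+1 %% p = (n %% p).+1.
      by rewrite -addn1 -modnDml addn1 modn_small.
    by rewrite /f e; move/(sortedP a): rx; apply.
  have -> : f n.+1 = a.
    rewrite /f (_ : n.+1 %% p = 0)//.
    rewrite -addn1 -modnDml addn1 (_ : (n %% p).+1 = p) ?modnn//; lia.
  by rewrite /f (_ : n %% p = size w) ?nth_last//; lia.
pose P := InfWord fP; exists P => //.
have PE n : x ^+ n = trunc P (n * p).
  elim: n => [|n IHn]; first exact: F2_word_inj.
  rewrite expgS IHn; apply: F2_word_inj.
  have cE : word x ++ mkseq P (n * p) = mkseq P (n.+1 * p).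
    apply: (@eq_from_nth _ a).
      by rewrite size_cat !size_mkseq xE mulSn.
    rewrite xE => i; rewrite size_cat size_mkseq => lti.
    rewrite nth_cat [RHS]nth_mkseq ?mulSn// -[size (a :: w)]/p.
    case: ltnP => [lt|ge]; first by rewrite /= /f modn_small.
    rewrite nth_mkseq; last by rewrite ltn_subLR.
    by rewrite /= /f -{2}(subnK ge) modnDr.
  by rewrite [LHS]/= mulw_cat cE//; apply: trunc_reduced.
apply/tends_toP => n; exists n => k nk; rewrite PE /= take_mkseq//.
by rewrite (leq_trans nk)// leq_pmulr.
Qed.

Lemma eq_tends_to (u v : nat -> F2) X :
  u =1 v -> tends_to u X -> tends_to v X.
Proof. by move=> /funext ->. Qed.

Lemma expgJ g h n : (g * h * g^-1) ^+ n = g * h ^+ n * g^-1.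
Proof.
elim: n => [|n IHn]; first by rewrite !expg0 mulg1 mulgV.
by rewrite !expgS IHn !mulgA mulgVK.
Qed.

Lemma act_inj g : injective (act (g : F2)).
Proof. exact: can_inj (actK g). Qed.

(** If [g] is cyclically reduced, the limits begin with the first letters of [g] and [g^-1], which
    differ. Otherwise [g] is a conjugate of a shorter element. *)
Lemma power_limits g : g <> 1 -> exists P Q : boundary,
  [/\ P <> Q, tends_to (fun n => g ^+ n) P & tends_to (fun n => g^-1 ^+ n) Q].
Proof.
have [n] := ubnP (size g); elim: n g => // n IHn g.
case gE: (word g) => [|a w] /= ltn g1.
  by case: g1; apply: F2_word_inj.
have [nal|] := boolP (a != letter_inv (last a w)); last first.
  rewrite negbK => /eqP al; case: (lastP w) al gE ltn => [|v b] /=.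
    by move=> e; have := letter_inv_neq a; rewrite {1}e eqxx.
  rewrite last_rcons size_rcons => al gE ltn.
  have rg := wordP g; rewrite gE in rg.
  have rv : reduced v.
    have : reduced (rcons v b) by move: rg; rewrite reduced_cons => /andP[].
    by rewrite -cats1 => /cat_sorted2[].
  pose h := ReducedWord rv; pose t := F2_letter a.
  have gJ : g = t * h * t^-1.
    apply: F2_word_inj; rewrite -mulgA gE.
    have -> : word (t * (h * t^-1)) = push a (mulw v [:: b]).
      by rewrite -[b]letter_invK -al.
    rewrite mulw_cat ?cats1 ?push_cons//.
    by move: rg; rewrite reduced_cons => /andP[].
  have [||P [Q [nPQ hP hQ]]] := IHn h.
  - by rewrite /=; lia.
  - by move=> h1; apply: g1; rewrite gJ h1 mulg1 mulgV.
  exists (act t P), (act t Q); split; first by move=> /act_inj.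
    apply: (eq_tends_to (u := fun n => t * h ^+ n * t^-1)) => [k|].
      by rewrite gJ expgJ.
    by apply: tends_to_mulr; apply: tends_to_act.
  apply: (eq_tends_to (u := fun n => t * h^-1 ^+ n * t^-1)) => [k|].
    by rewrite gJ !invgM invgK mulgA expgJ.
  by apply: tends_to_mulr; apply: tends_to_act.
have [P P0 gP] := cyclically_reduced_limit gE nal.
have gVE : word g^-1 = rcons (invw w) (letter_inv a).
  by rewrite /= gE /invw /= rev_cons.
case gVE' : (word g^-1) => [|b v]; first by move: gVE; rewrite gVE'; case: invw.
have bE : b = letter_inv (last a w).
  have := congr1 (head b) gVE'; rewrite /= gE /invw => <-.
  rewrite -map_rev; case: (lastP w) => [|w' c] //.
  by rewrite -rcons_cons rev_rcons /= last_rcons.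
have lE : last b v = letter_inv a.
  have -> : last b v = last b (word g^-1) by rewrite gVE'.
  by rewrite gVE last_rcons.
have [|Q Q0 gQ] := cyclically_reduced_limit gVE'.
  by rewrite lE letter_invK bE eq_sym.
exists P, Q; split => // ePQ; move: nal.
by rewrite -bE -Q0 -ePQ P0 eqxx.
Qed.

Lemma aut_expg phi g n : phi (g ^+ n) = phi g ^+ n.
Proof.
by elim: n => [|n IHn]; rewrite ?expg0 ?autF2_1// !expgS aut_morph IHn.
Qed.

Lemma power_limit_fixed phi g P :
  phi g = g -> tends_to (fun n => g ^+ n) P -> boundary_map phi P = P.
Proof.
move=> phig gP; apply: tends_to_unique (tends_to_map phi gP) _.
rewrite (_ : _ \o _ = fun n => g ^+ n)//.
by apply/funext => n; rewrite /= aut_expg phig.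
Qed.

Lemma fixed_boundary_point phi g X : g <> 1 -> phi g = g ->
  exists2 P, P <> X & boundary_map phi P = P.
Proof.
move=> g1 phig; have [P [Q [nPQ gP gQ]]] := power_limits g1.
have phiP := power_limit_fixed phig gP.
have phiQ : boundary_map phi Q = Q.
  by apply: power_limit_fixed gQ; rewrite autF2V phig.
have [ePX|nPX] := eqVneq P X; last by exists P => //; apply/eqP.
by exists Q => // eQX; apply: nPQ; rewrite ePX eQX.
Qed.

(** * The cyclic order on the boundary *)

Lemma letter_case (P : letter -> Prop) :
  P (ord0, false) -> P (ord_max, false) ->
  P (ord0, true) -> P (ord_max, true) ->
  forall a, P a.
Proof.
move=> P1 P2 P3 P4 [[[|[|//]] i] b].
  by rewrite (_ : Ordinal i = ord0); [case: b|apply/val_inj].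
by rewrite (_ : Ordinal i = ord_max); [case: b|apply/val_inj].
Qed.

(* The edges at each vertex of the Cayley tree are cyclically ordered as
   a, b, a^-1, b^-1, which is the ribbon structure of a once-punctured torus. *)
Definition letter_rank (a : letter) : nat := a.1 + a.2.*2.

(** [s = true] is the opposite orientation. *)
Definition cyclic (s : bool) (a b c : letter) : bool :=
  let: (i, j, k) := (letter_rank a, letter_rank b, letter_rank c) in
  if s then [|| i < k < j, k < j < i | j < i < k]
  else [|| i < j < k, j < k < i | k < i < j].

Definition distinct3 (a b c : letter) := [&& a != b, b != c & a != c].

Lemma cyclic_rot s a b c : cyclic s a b c = cyclic s b c a.
Proof.
by case: s; elim/letter_case: a; elim/letter_case: b; elim/letter_case: c.
Qed.

Lemma cyclic_distinct s a b c : cyclic s a b c -> distinct3 a b c.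
Proof.
by case: s; elim/letter_case: a; elim/letter_case: b; elim/letter_case: c.
Qed.

Lemma cyclic_total s a b c :
  distinct3 a b c -> cyclic s a b c || cyclic s a c b.
Proof.
by case: s; elim/letter_case: a; elim/letter_case: b; elim/letter_case: c.
Qed.

Lemma cyclic_flip s a b c : cyclic (~~ s) a b c = cyclic s a c b.
Proof. by case: s. Qed.

Lemma cyclic_asym s a b c : cyclic s a b c -> ~~ cyclic s a c b.
Proof.
by case: s; elim/letter_case: a; elim/letter_case: b; elim/letter_case: c.
Qed.

Lemma cyclic_trans s a b c d : cyclic s a b c -> cyclic s a c d ->
  cyclic s a b d /\ cyclic s b c d.
Proof.
by case: s; elim/letter_case: a; elim/letter_case: b; elim/letter_case: c;
  elim/letter_case: d.
Qed.

(* The cyclic order on the boundary given by the planar embedding of the tree: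
   some translation moves the centre of the tripod [X, Y, Z] to the origin. *)
Definition cord s X Y Z : Prop :=
  exists g : F2, cyclic s (act g X 0) (act g Y 0) (act g Z 0).

Lemma cord_act s g X Y Z :
  cord s (act (g : F2) X) (act g Y) (act g Z) <-> cord s X Y Z.
Proof.
split=> -[h hC]; first by exists (h * g); rewrite !actM.
by exists (h * g^-1); rewrite -!actM !mulgVK.
Qed.

Lemma cord_rot s X Y Z : cord s X Y Z -> cord s Y Z X.
Proof. by move=> [g gC]; exists g; rewrite -cyclic_rot. Qed.

Lemma cord_flip s X Y Z : cord (~~ s) X Y Z <-> cord s X Z Y.
Proof. by split=> -[g gC]; exists g; rewrite ?cyclic_flip// -cyclic_flip. Qed.

Lemma act_head_F2 g a w : word g = a :: w ->
  forall X, X 0 != letter_inv (last a w) -> act (a :: w) X 0 = a.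
Proof. by move=> gE X; apply: act_head; rewrite -gE; apply: wordP. Qed.

(** A nontrivial [g] sends every ray not starting with the inverse of its last letter to a ray
    starting with its first letter; at least two of the three rays are of this kind. *)
Lemma tripod_centre_unique g X Y Z : distinct3 (X 0) (Y 0) (Z 0) ->
  distinct3 (act (g : F2) X 0) (act g Y 0) (act g Z 0) -> g = 1.
Proof.
case gE: (word g) => [|a w]; first by move=> _ _; apply: F2_word_inj.
have gH := act_head_F2 gE; set t := letter_inv (last a w) in gH.
move=> /and3P[nXY nYZ nXZ] /and3P[nXY' nYZ' nXZ'].
have [Xt|/gH Xa] := eqVneq (X 0) t.
  by move: nYZ'; rewrite !gH ?eqxx// -Xt eq_sym.
have [Yt|/gH Ya] := eqVneq (Y 0) t.
  by move: nXZ'; rewrite Xa gH ?eqxx// -Yt eq_sym.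
by move: nXY'; rewrite Xa Ya eqxx.
Qed.

Lemma cord_head s X Y Z : distinct3 (X 0) (Y 0) (Z 0) -> cord s X Y Z ->
  cyclic s (X 0) (Y 0) (Z 0).
Proof.
move=> dXYZ [g gC]; have := cyclic_distinct gC.
by move=> /(tripod_centre_unique dXYZ) g1; move: gC; rewrite g1.
Qed.

Lemma head_cord s X Y Z : cyclic s (X 0) (Y 0) (Z 0) -> cord s X Y Z.
Proof. by exists 1. Qed.

(* The centre of the tripod lies in the direction of [V 0], and [X], [U] are
   both in other directions. *)
Lemma cord_subst s X U V W : V 0 = W 0 -> X 0 != V 0 -> U 0 != V 0 ->
  cord s X V W -> cord s U V W.
Proof.
move=> eVW nXV nUV [g]; case gE: (word g) => [|a w] gC.
  by have /and3P[_] := cyclic_distinct gC; rewrite /= eVW eqxx.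
exists g; rewrite gE; move: gC.
have gH := act_head_F2 gE; set t := letter_inv (last a w) in gH.
have [Vt|nVt gC] := eqVneq (V 0) t.
  by rewrite !(gH X) ?(gH U) -?Vt.
have /and3P[_] := cyclic_distinct gC.
by rewrite (gH V)// (gH W) ?eqxx// -eVW.
Qed.

Lemma cord_asym s X Y Z : cord s X Y Z -> ~ cord s X Z Y.
Proof.
move=> [g gC] /(cord_act s g) CXZY.
have /and3P[nXY nYZ nXZ] := cyclic_distinct gC.
suff : cyclic s (act g X 0) (act g Z 0) (act g Y 0).
  by rewrite (negbTE (cyclic_asym gC)).
by apply: cord_head CXZY; rewrite /distinct3 nXZ nXY eq_sym nYZ.
Qed.

(** The centre of [X], [U], [V] is at the origin. If [W] starts in the direction of [X] or of [V],
    [cord_subst] applies; otherwise the claim is about letters only. *)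
Lemma cord_trans_head s X U V W : cyclic s (X 0) (U 0) (V 0) -> cord s X V W ->
  cord s X U W /\ cord s U V W.
Proof.
move=> XUV XVW; have /and3P[nXU nUV nXV] := cyclic_distinct XUV.
have [eWX|nWX] := eqVneq (W 0) (X 0).
  split; last by apply: head_cord; rewrite eWX -cyclic_rot.
  apply: cord_rot; apply: cord_rot; apply: (@cord_subst s V) => //.
  - by rewrite eWX eq_sym.
  - by rewrite eWX eq_sym.
  - exact: cord_rot.
have [eWV|nWV] := eqVneq (W 0) (V 0).
  split; first by apply: head_cord; rewrite eWV.
  by apply: (@cord_subst s X) => //; rewrite eWV.
have {}XVW : cyclic s (X 0) (V 0) (W 0).
  by apply: cord_head XVW; rewrite /distinct3 nXV [V 0 == _]eq_sym nWV eq_sym.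
by have [? ?] := cyclic_trans XUV XVW; split; apply: head_cord.
Qed.

Lemma cord_trans s X U V W : cord s X U V -> cord s X V W ->
  cord s X U W /\ cord s U V W.
Proof.
move=> [g XUV] /(cord_act s g) /(cord_trans_head XUV)[].
by move=> /cord_act ? /cord_act.
Qed.

Lemma bpush_head X : bpush (letter_inv (X 0)) X =1 fun n => X n.+1.
Proof. by move=> n; rewrite /= /push_fun letter_invK eqxx. Qed.

(** Walk along the common prefix of [X] and [Y] to their fork; [Z] always stays behind, in the
    direction just left. *)
Lemma tripod_centre_fork n X Y Z : X n <> Y n -> Z 0 != X 0 -> Z 0 != Y 0 ->
  exists g : F2, distinct3 (act g X 0) (act g Y 0) (act g Z 0).
Proof.
elim: n X Y Z => [|n IHn] X Y Z nXY nZX nZY.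
  exists 1; rewrite /= /distinct3 ![_ == Z 0]eq_sym nZX nZY !andbT.
  exact/eqP.
have [eXY|nXY0] := eqVneq (X 0) (Y 0); last first.
  by exists 1; rewrite /= /distinct3 ![_ == Z 0]eq_sym nZX nZY !andbT.
pose a := letter_inv (X 0).
have aZ : bpush a Z 0 = a.
  by rewrite /= /push_fun letter_invK (negbTE nZX).
have [|||g gD] := IHn (bpush a X) (bpush a Y) (bpush a Z).
- by rewrite bpush_head /a eXY bpush_head.
- by rewrite aZ bpush_head eq_sym inf_wordP.
- by rewrite aZ /a eXY bpush_head eq_sym inf_wordP.
by exists (g * F2_letter a); rewrite !actM.
Qed.

Lemma boundary_diff X Y : X <> Y -> exists n, X n <> Y n.
Proof.
move=> nXY; apply: contrapT => e; apply/nXY/boundaryP => n.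
by apply: contrapT => ne; apply: e; exists n.
Qed.

Lemma tripod_centre_head X Y Z : X 0 != Y 0 -> Y <> Z -> X <> Z ->
  exists g : F2, distinct3 (act g X 0) (act g Y 0) (act g Z 0).
Proof.
move=> nXY nYZ nXZ.
have [eZX|nZX] := eqVneq (Z 0) (X 0).
  have [m nm] := boundary_diff nXZ.
  have [||g] := tripod_centre_fork (Z := Y) nm; rewrite ?eZX 1?eq_sym//.
  by case/and3P=> d1 d2 d3; exists g; rewrite /distinct3 d3 d1 eq_sym d2.
have [eZY|nZY] := eqVneq (Z 0) (Y 0).
  have [m nm] := boundary_diff nYZ.
  have [||g] := tripod_centre_fork (Z := X) nm; rewrite ?eZY//.
  case/and3P=> d1 d2 d3; exists g.
  by rewrite /distinct3 d1 [_ == act g Y 0]eq_sym d3 [_ == act g Z 0]eq_sym d2.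
by exists 1; rewrite /= /distinct3 ![_ == Z 0]eq_sym nZX nZY nXY.
Qed.

Lemma tripod_centre X Y Z : X <> Y -> Y <> Z -> X <> Z ->
  exists g : F2, distinct3 (act g X 0) (act g Y 0) (act g Z 0).
Proof.
move=> nXY nYZ nXZ; have [n] := boundary_diff nXY.
elim: n X Y Z nXY nYZ nXZ => [|n IHn] X Y Z nXY nYZ nXZ nn.
  by apply: tripod_centre_head => //; apply/eqP.
have [eXY|nXY0] := eqVneq (X 0) (Y 0); last exact: tripod_centre_head.
have [eZX|nZX] := eqVneq (Z 0) (X 0); last first.
  by apply: tripod_centre_fork nn _ _; rewrite -?eXY.
pose a := F2_letter (letter_inv (X 0)).
have [||||g gD] := IHn (act a X) (act a Y) (act a Z).
- by move=> /act_inj.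
- by move=> /act_inj.
- by move=> /act_inj.
- have aE U : act a U = bpush (letter_inv (X 0)) U by [].
  by rewrite !aE bpush_head eXY bpush_head.
by exists (g * a); rewrite !actM.
Qed.

Lemma cord_total s X Y Z : X <> Y -> Y <> Z -> X <> Z ->
  cord s X Y Z \/ cord s X Z Y.
Proof.
move=> nXY nYZ nXZ; have [g /cyclic_total-/(_ s)] := tripod_centre nXY nYZ nXZ.
by case/orP; [left|right]; exists g.
Qed.

(** The first letter of [act g X] depends only on the first [(size g).+1] letters of [X]. *)
Lemma cord_local s X Y Z : cord s X Y Z ->
  exists n, forall U, trunc U n = trunc X n -> cord s U Y Z.
Proof.
move=> [g gC]; exists (size g).+1 => U UX; exists g.
rewrite (@act_local g 1 U X)// => i lti.
have := congr1 (fun x : F2 => nth (X 0) x i) UX.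
by rewrite /= !nth_mkseq.
Qed.

Lemma cord_distinct s X Y Z : cord s X Y Z -> [/\ X <> Y, Y <> Z & X <> Z].
Proof.
move=> [g /cyclic_distinct/and3P[nXY nYZ nXZ]].
by split=> e; move: nXY nYZ nXZ; rewrite e eqxx.
Qed.

(* [t] tells whether [phi] reverses the cyclic order. *)
Definition preserves_cord phi : Prop := exists t, forall s X Y Z,
  cord s X Y Z ->
  cord (t (+) s) (boundary_map phi X) (boundary_map phi Y) (boundary_map phi Z).

Lemma preserves_cordM phi psi : preserves_cord phi -> preserves_cord psi ->
  preserves_cord (phi * psi).
Proof.
move=> [t phiC] [t' psiC]; exists (t (+) t') => s X Y Z C.
by rewrite -addbA !boundary_mapM; apply/phiC/psiC.
Qed.

(** By totality, a failure for [phi^-1] is a triple with the other orientation; mapping it back by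
    [phi] contradicts [cord_asym]. *)
Lemma preserves_cordV phi : preserves_cord phi -> preserves_cord phi^-1.
Proof.
move=> [t phiC]; exists t => s X Y Z C; have [nXY nYZ nXZ] := cord_distinct C.
have inj U V : boundary_map phi^-1 U = boundary_map phi^-1 V -> U = V.
  move=> /(congr1 (boundary_map phi)).
  by rewrite -!boundary_mapM mulgV !boundary_map1.
have [|||//|/phiC] := @cord_total (t (+) s) (boundary_map phi^-1 X)
  (boundary_map phi^-1 Y) (boundary_map phi^-1 Z); try by move=> /inj.
by rewrite addbA addbb -!boundary_mapM mulgV !boundary_map1 => /cord_asym.
Qed.

(** Since [phi] intertwines translations by [g] and [phi g], it suffices to treat tripods centred at
    the origin. *)
Lemma preserves_cord_head phi t :
  (forall s X Y Z, cyclic s (X 0) (Y 0) (Z 0) -> cord (t (+) s)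
     (boundary_map phi X) (boundary_map phi Y) (boundary_map phi Z)) ->
  preserves_cord phi.
Proof.
move=> phiC; exists t => s X Y Z [g /phiC].
by rewrite !boundary_map_act => /cord_act.
Qed.

Lemma preserves_cord_inner g : preserves_cord (inner g).
Proof. by exists false => s X Y Z C; rewrite !boundary_map_inner cord_act. Qed.

(** * Invariance of the cyclic order under Nielsen moves *)

Lemma eq_F2_hom (f g : F2 -> F2) : {morph f : x y / x * y} ->
  {morph g : x y / x * y} -> (forall i, f (basis i) = g (basis i)) -> f =1 g.
Proof.
move=> fM gM fg x; have [h [_ hU]] := F2_free (fun i => f (basis i)).
have <- : h = f by apply: hU.
by have <- : h = g by apply: hU; split => // i; rewrite fg.
Qed.

Lemma F2_hom (u : 'I_2 -> F2) :
  exists2 f : F2 -> F2, {morph f : x y / x * y} & forall i, f (basis i) = u i.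
Proof. by have [f [[fM fu] _]] := F2_free u; exists f. Qed.

Lemma aut_of_hom (f g : F2 -> F2) : {morph f : x y / x * y} ->
  {morph g : x y / x * y} -> (forall i, g (f (basis i)) = basis i) ->
  (forall i, f (g (basis i)) = basis i) ->
  exists phi, forall i, phi (basis i) = f (basis i).
Proof.
move=> fM gM gf fg; have fgM : {morph f \o g : x y / x * y}.
  by move=> x y /=; rewrite gM fM.
have gfM : {morph g \o f : x y / x * y} by move=> x y /=; rewrite fM gM.
have idM : {morph @id F2 : x y / x * y} by [].
have fK : cancel f g by apply: eq_F2_hom gfM idM gf.
have gK : cancel g f by apply: eq_F2_hom fgM idM fg.
by exists (AutF2 fM (Bijective fK gK)).
Qed.

(** For [a.1 != b.1], the signed permutation of the basis sending the first basis element to [a] and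
    the second to [b]. *)
Definition sigma (a b c : letter) : letter :=
  let d := if c.1 == ord0 then a else b in (d.1, d.2 (+) c.2).

Lemma aut_sigma a b : a.1 != b.1 ->
  exists phi, forall c, phi (F2_letter c) = F2_letter (sigma a b c).
Proof.
move=> nab.
have [f fM fE] := F2_hom (fun i => F2_letter (sigma a b (i, false))).
(* [sigma a' b'] is inverse to [sigma a b]; when the basis elements are swapped, the two signs are
   exchanged. *)
pose a' := if a.1 == ord0 then a else (a.1, b.2).
pose b' := if a.1 == ord0 then b else (b.1, a.2).
have [g gM gE] := F2_hom (fun i => F2_letter (sigma a' b' (i, false))).
have homL (h : F2 -> F2) c d : {morph h : x y / x * y} ->
    (forall i, h (basis i) = F2_letter (sigma c d (i, false))) ->
    forall e, h (F2_letter e) = F2_letter (sigma c d e).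
  move=> hM hE [i []]; last exact: hE.
  have h1 : h 1 = 1 by apply: (mulgI (h 1)); rewrite -hM !mulg1.
  apply: (mulgI (h (basis i))); rewrite -hM F2_letterE mulgV h1 hE.
  have -> : sigma c d (i, true) = letter_inv (sigma c d (i, false)).
    by rewrite /letter_inv /sigma /= addbF addbT.
  by apply: F2_word_inj; rewrite /= eqxx.
have [phi phiE] : exists phi, forall i, phi (basis i) = f (basis i).
  apply: (aut_of_hom fM gM) => i.
    rewrite fE (homL g _ _ gM gE); apply: F2_word_inj.
    rewrite /a' /b' /= {fM fE gM gE f g a' b' homL}.
    by move: nab; elim/letter_case: a; elim/letter_case: b;
      elim/letter_case: (i, false).
  rewrite gE (homL f _ _ fM fE); apply: F2_word_inj.
  rewrite /a' /b' /= {fM fE gM gE f g a' b' homL}.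
  by move: nab; elim/letter_case: a; elim/letter_case: b;
    elim/letter_case: (i, false).
exists phi; apply: homL; first exact: aut_morph.
by move=> i; rewrite phiE fE.
Qed.

Lemma F2_letter_inj : injective F2_letter.
Proof. by move=> a b /(congr1 (@word)) []. Qed.

Lemma F2_letterV a : (F2_letter a)^-1 = F2_letter (letter_inv a).
Proof. exact: F2_word_inj. Qed.

Section LetterAut.
Variables (phi : autF2) (f : letter -> letter).
Hypothesis phiE : forall c, phi (F2_letter c) = F2_letter (f c).

Lemma letter_aut_inj : injective f.
Proof.
by move=> a b e; apply/F2_letter_inj/(autF2_inj (phi := phi)); rewrite !phiE e.
Qed.

Lemma letter_autV a : f (letter_inv a) = letter_inv (f a).
Proof. by apply: F2_letter_inj; rewrite -phiE -!F2_letterV autF2V phiE. Qed.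

Lemma letter_aut_sigma c : f c = sigma (f (ord0, false)) (f (ord_max, false)) c.
Proof.
have fE i : f (i, true) = letter_inv (f (i, false)) by rewrite -letter_autV.
by elim/letter_case: c; rewrite ?fE /sigma /letter_inv /= ?addbF ?addbT//;
  case: (f _).
Qed.

Lemma letter_aut_indep : (f (ord0, false)).1 != (f (ord_max, false)).1.
Proof.
apply/eqP => e.
have : f (ord0, false) = f (ord_max, false) \/
       f (ord0, false) = f (letter_inv (ord_max, false)).
  rewrite letter_autV; move: (f _) (f _) e => [i b] [j c] /= ->.
  by rewrite /letter_inv /=; case: b; case: c; auto.
by case=> /letter_aut_inj.
Qed.

Lemma letter_aut_word x : word (phi x) = map f x.
Proof.
elim/F2_elim: x => [|a x rax IHx]; first by rewrite autF2_1.
have -> : word (phi (F2_letter a * x)) = push (f a) (map f x).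
  by rewrite aut_morph phiE /= IHx.
rewrite /= (push_cons rax) push_cons//.
by move: rax; rewrite /reduced /= path_map; apply: sub_path => b c /=;
  rewrite -letter_autV (inj_eq letter_aut_inj).
Qed.

Lemma letter_aut_head X : boundary_map phi X 0 = f (X 0).
Proof.
have [M phiM] := boundary_map_unif phi 1%N.
have := phiM X M.+1 (leqnSn M); rewrite letter_aut_word /= => -[->].
by [].
Qed.

End LetterAut.

(** Signed permutations are the symmetries of the square with vertices a, b, a^-1, b^-1: rotations
    keep the cyclic order, reflections reverse it. *)
Lemma cyclic_sigma (a b : letter) : a.1 != b.1 -> exists t, forall s c d e,
  cyclic s c d e ->
  cyclic (t (+) s) (sigma a b c) (sigma a b d) (sigma a b e).
Proof.
by elim/letter_case: a; elim/letter_case: b => // _;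
  [exists false|exists true|exists true|exists false|
   exists true|exists false|exists false|exists true];
  case; do 3!elim/letter_case.
Qed.

Lemma preserves_cord_letters phi (f : letter -> letter) :
  (forall c, phi (F2_letter c) = F2_letter (f c)) -> preserves_cord phi.
Proof.
move=> phiE; have [t tC] := cyclic_sigma (letter_aut_indep phiE).
apply: (@preserves_cord_head _ t) => s X Y Z /tC C; apply: head_cord.
rewrite !(letter_aut_head phiE) (letter_aut_sigma phiE (X 0)).
by rewrite (letter_aut_sigma phiE (Y 0)) (letter_aut_sigma phiE (Z 0)).
Qed.

Lemma aut_nu : exists phi,
  [/\ phi (F2_letter (ord0, false)) = F2_letter (ord0, false) &
      phi (F2_letter (ord_max, false)) =
    F2_letter (ord0, false) * F2_letter (ord_max, false)].
Proof.
pose a := basis ord0; pose b := basis ord_max.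
have [f fM fE] := F2_hom (fun i => if i == ord0 then a else a * b).
have [g gM gE] := F2_hom (fun i => if i == ord0 then a else a^-1 * b).
have gV x : g x^-1 = (g x)^-1.
  have g1 : g 1 = 1 by apply: (mulgI (g 1)); rewrite -gM !mulg1.
  by apply: (mulgI (g x)); rewrite -gM !mulgV.
have fV x : f x^-1 = (f x)^-1.
  have f1 : f 1 = 1 by apply: (mulgI (f 1)); rewrite -fM !mulg1.
  by apply: (mulgI (f x)); rewrite -fM !mulgV.
have iE (i : 'I_2) : i = ord0 \/ i = ord_max.
  by case: i => [[|[|//]]] ?; [left|right]; apply/val_inj.
have [phi phiE] : exists phi, forall i, phi (basis i) = f (basis i).
  apply: (aut_of_hom fM gM) => i; case: (iE i) => ->; rewrite ?fE ?gE /=;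
    rewrite ?fM ?gM ?fV ?gV ?fE ?gE //= ?mulKg ?mulVKg//.
by exists phi; split;
  [apply: etrans (phiE ord0) _|apply: etrans (phiE ord_max) _]; rewrite fE.
Qed.

(* The possible beginnings of the image [v] of [w] under [a -> a, b -> ab],
   according to the first letter of [w]. *)
Definition nu_shape (w v : seq letter) : bool :=
  match w with
  | [::] => v == [::]
  | c :: _ =>
    if c == (ord0, false) then
      if v is d :: v' then (d == (ord0, false)) &&
        (if v' is e :: _ then (e == (ord0, false)) || (e == (ord_max, true))
         else true)
      else false
    else if c == (ord_max, false) then
      if v is [:: d, e & _] then (d == (ord0, false)) && (e == (ord_max, false))
      else false
    else if c == (ord0, true) then
      if v is d :: _ then (d == (ord0, true)) || (d == (ord_max, false))
      else false
    else if v is d :: _ then d == (ord_max, true) else false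
  end.

Section Nu.
Variable nu : autF2.
Hypothesis nu_a : nu (F2_letter (ord0, false)) = F2_letter (ord0, false).
Hypothesis nu_b : nu (F2_letter (ord_max, false)) =
  F2_letter (ord0, false) * F2_letter (ord_max, false).

(** The shape of the image of the tail determines what cancels when the image of one more letter is
    prepended. *)
Lemma nu_word x : nu_shape x (nu x).
Proof.
elim/F2_elim: x => [|c x rcx IHx]; first by rewrite autF2_1.
have -> : word (F2_letter c * x) = c :: x by rewrite /= push_cons.
have nu_A : nu (F2_letter (ord0, true)) = F2_letter (ord0, true).
  have -> : F2_letter (ord0, true) = (F2_letter (ord0, false))^-1.
    exact: F2_word_inj.
  by rewrite autF2V nu_a.
have nu_B : nu (F2_letter (ord_max, true)) =
    F2_letter (ord_max, true) * F2_letter (ord0, true).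
  have -> : F2_letter (ord_max, true) = (F2_letter (ord_max, false))^-1.
    exact: F2_word_inj.
  rewrite autF2V nu_b invgM; congr (_ * _); exact: F2_word_inj.
rewrite aut_morph [word (_ * _)]/=.
have -> : word (nu (F2_letter c)) =
   if c == (ord0, false) then [:: (ord0, false)] else
   if c == (ord_max, false) then [:: (ord0, false); (ord_max, false)] else
   if c == (ord0, true) then [:: (ord0, true)] else
   [:: (ord_max, true); (ord0, true)].
  by elim/letter_case: c {rcx}; rewrite ?nu_a ?nu_b ?nu_A ?nu_B.
move: (word (nu x)) (word x) rcx IHx {nu_A nu_B} => v w.
case: w => [|b w] rcx.
  by move=> /eqP ->; elim/letter_case: c {rcx}.
have : b != letter_inv c by move: rcx; rewrite reduced_cons => /andP[].
case: v => [|d v]; first by elim/letter_case: b {rcx}.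
by elim/letter_case: c {rcx}; elim/letter_case: b => //= _;
  elim/letter_case: d => //=; case: v => [|e v] //=;
  elim/letter_case: e.
Qed.

(* The possible values of the first letters of [Z], of its image [W], and of the
   translate of [W] by the inverse of the first basis element. *)
Definition nu_heads : seq (letter * letter * letter) :=
  [:: (ord0, false, (ord0, false), (ord0, false));
      (ord0, false, (ord0, false), (ord_max, true));
      (ord_max, false, (ord0, false), (ord_max, false));
      (ord0, true, (ord0, true), (ord0, true));
      (ord0, true, (ord_max, false), (ord0, true));
      (ord_max, true, (ord_max, true), (ord0, true))].

Lemma nu_headsP Z :
  (Z 0, boundary_map nu Z 0, act [:: (ord0, true)] (boundary_map nu Z) 0)
    \in nu_heads.
Proof.
set W := boundary_map nu Z; have [M nuM] := boundary_map_unif nu 2.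
have := nu_word (trunc Z M.+1); have := nuM Z M.+1 (leqnSn M).
rewrite -/W /= /push_fun; case: (word (nu _)) => [|d [|e v]] //= [-> ->].
move: (Z 0) d e; do 3![elim/letter_case] => //.
Qed.

(** The image of a tripod centred at the origin is centred at the origin or at the vertex of the
    first basis element, which is a finite check. *)
Lemma nu_heads_cyclic s (p q r : letter * letter * letter) :
  p \in nu_heads -> q \in nu_heads -> r \in nu_heads ->
  cyclic s p.1.1 q.1.1 r.1.1 ->
  cyclic s p.1.2 q.1.2 r.1.2 || cyclic s p.2 q.2 r.2.
Proof.
move=> pH qH rH; apply/implyP; move: s.
suff : all (fun p => all (fun q => all (fun r => all (fun s =>
    cyclic s p.1.1 q.1.1 r.1.1 ==>
    cyclic s p.1.2 q.1.2 r.1.2 || cyclic s p.2 q.2 r.2)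
    [:: true; false]) nu_heads) nu_heads) nu_heads.
  move=> /allP/(_ p pH)/allP/(_ q qH)/allP/(_ r rH)/= /and3P[? ? _].
  by case.
by vm_compute.
Qed.

Lemma preserves_cord_nu : preserves_cord nu.
Proof.
apply: (@preserves_cord_head _ false) => s X Y Z C.
have /orP[] := nu_heads_cyclic (nu_headsP X) (nu_headsP Y) (nu_headsP Z) C.
  exact: head_cord.
by exists (F2_letter (ord0, true)).
Qed.

End Nu.

(** * Nielsen reduction *)

(** [x] splits into the part surviving in [x * y] and the part cancelled by [y]. *)
Lemma lcp_F2M x y : lcp (x * y) x + lcp x^-1 y = size x.
Proof.
have := size_F2_div (x * y) x; have := size_F2_div x^-1 y.
rewrite invgK !size_F2V invgM mulgVK size_F2V.
have := lcp_sizel (x^-1) y; have := lcp_sizer (x * y) x; rewrite size_F2V.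
move: (size (x * y)); lia.
Qed.

Lemma nth_invw (a : letter) u i : i < size u ->
  nth a (invw u) i = letter_inv (nth a u (size u - i.+1)).
Proof.
move=> ltiu; rewrite /invw nth_rev size_map// (nth_map a)//; lia.
Qed.

(** Otherwise the middle letter of [x] would be its own inverse, or its two middle letters would
    cancel. *)
Lemma lcp_invg x : x <> 1 -> (lcp x^-1 x).*2 < size x.
Proof.
move=> x1; rewrite ltnNge; apply/negP => le.
have s0 : 0 < size x by rewrite lt0n size_F2_eq0; apply/eqP.
have [a _] : exists a : letter, true by exists (ord0, false).
have nE i : i < lcp x^-1 x -> nth a x i = letter_inv (nth a x (size x - i.+1)).
  move=> lti; have := lcp_sizer x^-1 x => lex.
  rewrite -nth_invw; last exact: leq_trans lti lex.
  have /(congr1 (nth a ^~ i)) := lcp_take (leqnn (lcp x^-1 x)).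
  by rewrite !nth_take.
have := odd_double_half (size x); set k := (size x)./2.
case: (odd (size x)) => /= kE.
  have := nE k; rewrite (_ : size x - k.+1 = k)%N; last by lia.
  have := letter_inv_neq (nth a x k); move=> /eqP ne xk; apply/ne/xk.
  by lia.
have := nE k.-1; rewrite (_ : size x - k.-1.+1 = k)%N; last by lia.
have /(sortedP a)/(_ k.-1) := wordP x; rewrite prednK; last by lia.
move=> + xk; rewrite xk ?letter_invK ?eqxx; last by lia.
by move=> /(_ _)/negP; apply; lia.
Qed.

(** The number of letters of each factor cancelled in [phi (F2_letter a) * phi (F2_letter b)]. *)
Definition gromov phi (a b : letter) :=
  lcp (phi (F2_letter a))^-1 (phi (F2_letter b)).

(** By Nielsen's condition, cancellation with both neighbours leaves at least one letter of the
    image of each letter. *)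
Lemma nielsen_length phi :
  (forall a b c, b != letter_inv a -> c != letter_inv b ->
     gromov phi a b + gromov phi b c < size (phi (F2_letter b))) ->
  forall x, size x <= size (phi x).
Proof.
(* The induction carries a possible preceding letter [a] and sets aside the letters that its image
   would cancel. *)
move=> N x; suff P : forall a b w, word x = b :: w -> b != letter_inv a ->
    lcp (phi (F2_letter a))^-1 (phi x) = gromov phi a b /\
    size x + gromov phi a b <= size (phi x).
  case xE: (word x) => [|b w] //; rewrite -xE.
  have [_] := P b b w xE (letter_inv_neq b).
  by apply: leq_trans; apply: leq_addr.
elim/F2_elim: x => // c x rcx IHx a b w.
have -> : word (F2_letter c * x) = c :: x by rewrite /= push_cons.
move=> [<- _] {b w} nca.
have := N a c c nca (letter_inv_neq c).
rewrite aut_morph; case xE: (word x) => [|d w].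
  have -> : x = 1 by apply: F2_word_inj.
  by rewrite autF2_1 mulg1 /=; rewrite -/(gromov _ _ _); lia.
move=> _; rewrite xE in rcx.
have ndc : d != letter_inv c by move: rcx; rewrite reduced_cons => /andP[].
have [cE cS] := IHx c d w xE ndc; have Nac := N a c d nca ndc.
have lcM := lcp_F2M (phi (F2_letter c)) (phi x); rewrite cE in lcM.
have le : gromov phi a c < lcp (phi (F2_letter c)) (phi (F2_letter c) * phi x).
  by rewrite lcpC; lia.
split; first exact: lcp_isosceles.
have := size_F2_div (phi (F2_letter c))^-1 (phi x); rewrite cE invgK size_F2V.
by rewrite /= -?xE; move: (size (mulw _ _)) cS; rewrite ?xE /=; lia.
Qed.

(** Here [phi^-1] does not lengthen words, so it permutes the letters. *)
Lemma preserves_cord_nielsen phi :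
  (forall x, size x <= size (phi x)) -> preserves_cord phi.
Proof.
move=> phiS; rewrite -[phi]invgK; apply: preserves_cordV.
have letters a : exists b, phi^-1 (F2_letter a) = F2_letter b.
  have := phiS (phi^-1 (F2_letter a)); rewrite [phi _](aut_inv_funK phi).
  case xE: (word (phi^-1 (F2_letter a))) => [|b [|//]] _.
    have /(congr1 phi) : phi^-1 (F2_letter a) = 1 by apply: F2_word_inj.
    by rewrite [LHS](aut_inv_funK phi) autF2_1 => /(congr1 (@word)).
  by exists b; apply: F2_word_inj.
pose f a := projT1 (cid (letters a)).
by apply: (@preserves_cord_letters _ f) => a; apply: projT2 (cid (letters a)).
Qed.

Definition aut_size phi :=
  size (phi (F2_letter (ord0, false))) +
  size (phi (F2_letter (ord_max, false))).

Lemma size_aut_letterV phi a :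
  size (phi (F2_letter (letter_inv a))) = size (phi (F2_letter a)).
Proof. by rewrite -F2_letterV autF2V size_F2V. Qed.

Lemma aut_sizeE phi (a b : letter) : a.1 != b.1 ->
  aut_size phi = size (phi (F2_letter a)) + size (phi (F2_letter b)).
Proof.
have sE i s : size (phi (F2_letter (i, s))) = size (phi (F2_letter (i, false))).
  case: s => //.
  by rewrite -[(i, true)]/(letter_inv (i, false)) size_aut_letterV.
rewrite /aut_size; elim/letter_case: a; elim/letter_case: b => // _;
  by rewrite ?(sE ord0 true) ?(sE ord_max true) // addnC.
Qed.

(** A Nielsen move: the images of [a] and [b] under [phi] are replaced by the first of them and
    their product. *)
Lemma transvection phi (a b : letter) : a.1 != b.1 -> exists psi,
  aut_size psi = size (phi (F2_letter a)) +
                 size (phi (F2_letter a) * phi (F2_letter b)) /\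
  (preserves_cord psi -> preserves_cord phi).
Proof.
move=> nab; have [pi piE] := aut_sigma nab.
have [nu [nu_a nu_b]] := aut_nu.
exists (phi * (pi * nu)); split.
  rewrite /aut_size /= nu_a nu_b aut_morph !piE aut_morph.
  by rewrite /sigma /= !addbF -!surjective_pairing.
move=> C; rewrite -[phi](mulgK (pi * nu)); apply: preserves_cordM => //.
apply: preserves_cordV; apply: preserves_cordM.
  exact: preserves_cord_letters piE.
exact: preserves_cord_nu.
Qed.

Lemma preserves_cord_innerM g phi :
  preserves_cord (inner g * phi) -> preserves_cord phi.
Proof.
move=> C; rewrite -[phi](mulKg (inner g)); apply: preserves_cordM => //.
exact/preserves_cordV/preserves_cord_inner.
Qed.

(* If [y] ends with [p^-1] and begins with [q], where [x = p q^-1] and [p], [q]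
   have the same length, then conjugation by [p] cancels both ends in [x y]. *)
Lemma half_cancellation x y (h : nat) : size x = h.*2 -> h.*2 <= size y ->
  h <= lcp y^-1 x -> lcp x^-1 y = h -> exists p : F2,
  size (p^-1 * x * p) <= h.*2 /\ size (p^-1 * (x * y) * p) + h.*2 <= size y.
Proof.
move=> xh hy yx xy; exists (pfx x h); set p := pfx x h.
have ph : size p = h by rewrite size_takel// xh; lia.
have px : size (p^-1 * x) = h.
  have := size_F2_div p x; rewrite lcp_takel xh ph.
  by move: (size (mulw _ _)); lia.
split; first by apply: leq_trans (size_F2M _ _) _; rewrite px ph addnn.
have xyx : h <= lcp (x * y) x by have := lcp_F2M x y; lia.
have pxy : h <= lcp p (x * y).
  by apply: (@lcp_trans _ x); rewrite ?lcp_takel ?xh 1?lcpC//; lia.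
have s1 : size (p^-1 * (x * y)) + h <= size y.
  have := size_F2_div p (x * y); have := size_F2_div x^-1 y.
  rewrite invgK size_F2V xy xh ph.
  by move: (size (x * y : F2)) (size (p^-1 * (x * y) : F2)) pxy; lia.
have lv : h <= lcp (p^-1 * (x * y))^-1 p.
  have vE : (p^-1 * (x * y))^-1 = y^-1 * (p^-1 * x)^-1.
    by rewrite !invgM invgK mulgA.
  apply: (@lcp_trans _ y^-1).
    rewrite vE; have := lcp_F2M y^-1 (p^-1 * x)^-1.
    have := lcp_sizer y^-1^-1 (p^-1 * x)^-1; rewrite size_F2V px size_F2V.
    by move: (lcp _ (word y^-1)); lia.
  by apply: (@lcp_trans _ x) => //; rewrite lcpC lcp_takel xh; lia.
have := size_F2_div (p^-1 * (x * y))^-1 p; rewrite invgK size_F2V ph.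
move: (size (p^-1 * (x * y) * p : F2)) (size (p^-1 * (x * y) : F2)) s1 lv.
by lia.
Qed.

Lemma aut_preserves_cord phi : preserves_cord phi.
Proof.
have [n] := ubnP (aut_size phi); elim: n phi => // n IHn phi.
rewrite ltnS => len.
apply: contrapT => nphi.
(* Stated for any [psi] in order to apply also to a conjugate of [phi]. *)
have no_shorter psi (a b : letter) :
    (preserves_cord psi -> preserves_cord phi) ->
    a.1 != b.1 -> aut_size phi <= size (psi (F2_letter a)) +
                     size (psi (F2_letter a) * psi (F2_letter b)).
  move=> psiphi nab; have [xi [<- xiC]] := transvection psi nab.
  rewrite leqNgt; apply/negP => lt; apply/nphi/psiphi/xiC/IHn.
  exact: leq_trans lt len.
have sphi a : 0 < size (phi (F2_letter a)).
  rewrite lt0n size_F2_eq0; apply/eqP; rewrite -(autF2_1 phi) => /autF2_inj.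
  by move=> /(congr1 (@word)).
(* The moves on [a, b] and on [b^-1, a^-1] do not shorten, so at most half of either image
   cancels. *)
have half (a b : letter) : a.1 != b.1 ->
    (gromov phi a b).*2 <= size (phi (F2_letter b)) /\
    (gromov phi a b).*2 <= size (phi (F2_letter a)).
  move=> nab; have := no_shorter phi a b id nab.
  have := no_shorter phi (letter_inv b) (letter_inv a) id.
  rewrite eq_sym => /(_ nab); rewrite (aut_sizeE phi nab).
  rewrite -!F2_letterV !autF2V -invgM !size_F2V.
  have := size_F2_div (phi (F2_letter a))^-1 (phi (F2_letter b)).
  rewrite invgK size_F2V -/(gromov _ _ _).
  by move: (size (mulw _ _)); lia.
have strict b : (gromov phi b b).*2 < size (phi (F2_letter b)).
  apply: lcp_invg; rewrite -(autF2_1 phi) => /autF2_inj.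
  by move=> /(congr1 (@word)).
apply: nphi; apply: preserves_cord_nielsen.
apply: nielsen_length => a b c nba ncb.
have dich (d e : letter) : e != letter_inv d -> d = e \/ d.1 != e.1.
  by elim/letter_case: d; elim/letter_case: e => // _; auto.
have [eab|nab] := dich _ _ nba; have [ebc|nbc] := dich _ _ ncb.
- by rewrite eab ebc; have := strict c; lia.
- by rewrite eab; have := strict b; have := half _ _ nbc; lia.
- by rewrite -ebc; have := strict b; have := half _ _ nab; lia.
have [hb1 ha] := half _ _ nab; have [hc hb2] := half _ _ nbc.
(* Nielsen's condition can fail only if each neighbour cancels exactly half of the image of [b]. *)
rewrite ltnNge; apply/negP => le.
pose h := gromov phi a b.
have bE : size (phi (F2_letter b)) = h.*2 by rewrite /h; lia.
have hE : gromov phi b c = h by rewrite /h; lia.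
have [eca|eca] : c = a \/ c = letter_inv a.
  by move: nab nbc; elim/letter_case: a {nba hb1 ha le h bE hE};
    elim/letter_case: b {ncb hb2 hc};
    elim/letter_case: c => // _; auto.
(* For [c = a], conjugation by [p] followed by a Nielsen move brings the total length down to at
   most that of [phi (F2_letter a)]. *)
- have [||||p [p1 p2]] :=
      @half_cancellation (phi (F2_letter b)) (phi (F2_letter a)) h.
  + by [].
  + by rewrite /h; lia.
  + exact: leqnn.
  + by rewrite -hE eca.
  have := no_shorter (inner p^-1 * phi) b a (@preserves_cord_innerM _ _) _.
  rewrite eq_sym => /(_ nab).
  have psiE x : (inner p^-1 * phi) x = p^-1 * phi x * p.
    by rewrite -[LHS]/(p^-1 * phi x * p^-1^-1) invgK.
  rewrite -aut_morph !psiE aut_morph.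
  by rewrite (aut_sizeE phi nab) bE; have := sphi b; rewrite bE; lia.
(* For [c = letter_inv a], the image of [b] and its inverse both share [h] letters with the inverse
   of the image of [a], hence with each other. *)
have := strict b; have : h <= gromov phi b b; last by lia.
apply: (@lcp_trans _ (phi (F2_letter a))^-1).
  by rewrite -hE /gromov eca -F2_letterV autF2V.
exact: leqnn.
Qed.

(** * Parabolic orbits *)

Lemma preserves_cord_square phi s X Y Z : preserves_cord phi -> cord s X Y Z ->
  cord s (boundary_map (phi ^+ 2) X) (boundary_map (phi ^+ 2) Y)
         (boundary_map (phi ^+ 2) Z).
Proof.
move=> [t phiC] /phiC/phiC.
by rewrite addbA addbb addFb -!boundary_mapM -expg2.
Qed.

(* The orbit of [Y] increases in the interval from [Y] to the fixed point [P],
   whose closure misses [X]. *)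
Lemma monotone_orbit phi s X Y P :
  (forall U V W, cord s U V W ->
     cord s (boundary_map phi U) (boundary_map phi V) (boundary_map phi W)) ->
  boundary_map phi X = X -> boundary_map phi P = P ->
  cord s X Y P -> cord s X Y (boundary_map phi Y) ->
  ~ converges (fun k => boundary_map (phi ^+ k) Y) X.
Proof.
move=> phiC phiX phiP XYP XYY cX; pose y k := boundary_map (phi ^+ k) Y.
have yS k : y k.+1 = boundary_map phi (y k) by rewrite /y expgS boundary_mapM.
have Xy k : cord s X Y (y k.+1).
  elim: k => [|k IHk]; first by rewrite /y expg1.
  have := phiC _ _ _ IHk; rewrite -yS phiX.
  by case/(cord_trans XYY).
have yP k : cord s X (y k) P.
  elim: k => [|k IHk]; first by rewrite /y expg0 boundary_map1.
  by have := phiC _ _ _ IHk; rewrite -yS phiX phiP.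
(* Any [U] close to [X] satisfies [cord s U Y P], whereas the orbit stays between [Y] and [P]. *)
have [n nC] := cord_local XYP; have [K XK] := cX n.
have [_] := cord_trans (Xy K) (yP K.+1).
by move=> /cord_rot/cord_asym; apply; apply/nC/XK.
Qed.

Lemma converges_square phi X Y :
  converges (fun k => boundary_map (phi ^+ k) Y) X ->
  converges (fun k => boundary_map ((phi ^+ 2) ^+ k) Y) X.
Proof.
move=> cX n; have [K XK] := cX n; exists K => k Kk.
by rewrite -expgnA; apply: XK; lia.
Qed.

Theorem proposition1p2 : ~ exists phi : autF2, parabolic_orbit phi.
Proof.
move=> [phi [X [Y [nXY /cvg_converges cX /cvg_converges cVX]]]].
have [g g1 phig] := parabolic_fixes nXY cX cVX.
have [P nPX phiP] := fixed_boundary_point X g1 phig.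
have sq psi U : boundary_map psi U = U -> boundary_map (psi ^+ 2) U = U.
  by move=> psiU; rewrite expg2 boundary_mapM !psiU.
have fixV psi U : boundary_map psi U = U -> boundary_map psi^-1 U = U.
  by move=> psiU; rewrite -{1}psiU boundary_mapK.
have {cVX} cVX : converges (fun k => boundary_map (phi^-1 ^+ k) Y) X.
  by move=> n; have [K XK] := cVX n; exists K => k /XK; rewrite expVgn.
have phiX := converges_fixed cX.
have cX2 := converges_square cX.
have movesY psi : converges (fun k => boundary_map (psi ^+ k) Y) X ->
    boundary_map psi Y <> Y.
  move=> psiX psiY; apply: nXY; apply: converges_cst.
  move=> n; have [K XK] := psiX n; exists K => k /XK <-; congr (trunc _ n).
  elim: k => [|k IHk]; first by rewrite expg0 boundary_map1.
  by rewrite expgS boundary_mapM -IHk.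
have nYP : Y <> P by move=> eYP; apply: (movesY _ cX); rewrite eYP.
have [s XYP] : exists s, cord s X Y P.
  have [|||C|C] := @cord_total false X Y P => //.
  - by move=> eXP; apply: nPX.
  - by exists false.
  by exists true; apply/(cord_flip false).
have C2 := preserves_cord_square (aut_preserves_cord phi).
have CV2 := preserves_cord_square (aut_preserves_cord phi^-1).
(* If [phi ^+ 2] moves [Y] towards [P], the forward orbit cannot reach [X]; otherwise its inverse
   moves [Y] towards [P], and the backward orbit cannot. *)
have [|||C|C] := @cord_total s X Y (boundary_map (phi ^+ 2) Y) => //.
- by move=> e; apply: (movesY _ cX2).
- rewrite -{1}(sq _ _ phiX) => /(congr1 (boundary_map (phi ^- 2))).
  by rewrite !boundary_mapK.
- by apply: (monotone_orbit _ _ _ XYP C cX2); auto.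
apply: (monotone_orbit (phi := phi^-1 ^+ 2) _ _ _ XYP _ (converges_square cVX)).
- by move=> U V W; apply: CV2.
- exact/sq/fixV.
- exact/sq/fixV.
have := CV2 _ _ _ _ C; rewrite sq; last exact: fixV.
by rewrite expVgn boundary_mapK.
Qed.
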